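(* There exist a complex Hilbert space $H$, a bounded linear operator $T$ on $H$, and a bounded open set $\Omega\subset\mathbb{C}$ containing the spectrum of $T$ such that both of the following hold: (i) for each $f\in A(\Omega)$ there exists $g\in A(\Omega)$ such that \[ \|g\|_\Omega\le\|f\|_\Omega \quad\text{and}\quad \|f(T)+g(T)^*\|\le 2\|f\|_\Omega ; \] (ii) there exists a non-zero $f\in A(\Omega)$ such that \[ \|f(T)\|=(1+\sqrt{2})\,\|f\|_\Omega . \]
   Context: For a bounded open set $\Omega\subset\mathbb{C}$, $A(\Omega)$ denotes the algebra of continuous functions $f:\overline{\Omega}\to\mathbb{C}$ that are holomorphic on $\Omega$, and $\|f\|_\Omega:=\sup_{z\in\Omega}|f(z)|$. ($\Omega$ is not assumed connected.) For $f\in A(\Omega)$ and a bounded operator $T$ on $H$ with spectrum contained in $\Omega$, $f(T)$ is defined by the holomorphic functional calculus (Cauchy integral $\frac{1}{2\pi i}\int f(\zeta)(\zeta I-T)^{-1}\,d\zeta$ over a cycle in $\Omega$ surrounding the spectrum of $T$). $\|\cdot\|$ on operators is the operator norm and $^*$ denotes the Hilbert-space adjoint. *)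

(* Defs.v *)
From Stdlib Require Import Reals Lra List ClassicalEpsilon.
From Stdlib Require Import FunctionalExtensionality ProofIrrelevance.
From Coquelicot Require Import Coquelicot.

Set Implicit Arguments.
Unset Strict Implicit.

Open Scope R_scope.

(** * Hilbert spaces *)

(* Linear in the first argument; definiteness follows from [inner_norm]. *)
Record Hilbert := {
  hilbert_space :> CompleteNormedModule C_AbsRing;
  inner : hilbert_space -> hilbert_space -> C;
  inner_plus : forall x y z, inner (plus x y) z = Cplus (inner x z) (inner y z);
  inner_scal : forall (a : C) x y,
    inner (scal (K := C_AbsRing) a x) y = Cmult a (inner x y);
  inner_conj : forall x y, inner y x = Cconj (inner x y);
  inner_norm : forall x, inner x x = RtoC (norm x ^ 2)
}.

(** * Restriction of scalars

    Coquelicot's Riemann integral is defined for functions with values in a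
    real normed module; a complex one is viewed as such through [RtoC]. *)

Section RealScalars.

Context (V : NormedModule C_AbsRing).

Definition rscal (r : R) (x : V) : V := scal (K := C_AbsRing) (RtoC r) x.

Lemma rscal_assoc (x y : R) (u : V) : rscal x (rscal y u) = rscal (mult x y) u.
Proof.
unfold rscal; rewrite scal_assoc; apply (f_equal (fun c => scal (K := C_AbsRing) c u)).
exact (eq_sym (RtoC_mult x y)).
Qed.

Lemma rscal_one (u : V) : rscal one u = u.
Proof. exact (scal_one u). Qed.

Lemma rscal_plus_r (x : R) (u v : V) :
  rscal x (plus u v) = plus (rscal x u) (rscal x v).
Proof. exact (scal_distr_l (RtoC x) u v). Qed.

Lemma rscal_plus_l (x y : R) (u : V) :
  rscal (plus x y) u = plus (rscal x u) (rscal y u).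
Proof.
unfold rscal.
transitivity (scal (plus (RtoC x) (RtoC y) : C_AbsRing) u).
- apply (f_equal (fun c => scal (K := C_AbsRing) c u)); exact (RtoC_plus x y).
- exact (scal_distr_r (RtoC x) (RtoC y) u).
Qed.

Definition real_ModuleSpace_mixin :=
  ModuleSpace.Mixin R_Ring V rscal
    rscal_assoc rscal_one rscal_plus_r rscal_plus_l.

Definition real_NormedModuleAux_class : NormedModuleAux.class_of R_AbsRing V :=
  NormedModuleAux.Class R_AbsRing V
    (ModuleSpace.Class R_Ring V (AbelianGroup.class V) real_ModuleSpace_mixin)
    (UniformSpace.class V).

Definition real_NormedModuleAux : NormedModuleAux R_AbsRing :=
  NormedModuleAux.Pack R_AbsRing V real_NormedModuleAux_class V.

Lemma rscal_norm (r : R) (x : V) : norm (rscal r x) <= Rabs r * norm x.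
Proof.
rewrite <- Cmod_R; exact (norm_scal (RtoC r) x).
Qed.

Definition real_NormedModule_mixin :=
  NormedModule.Mixin R_AbsRing real_NormedModuleAux
    (@norm C_AbsRing V) (@norm_factor C_AbsRing V)
    (@norm_triangle C_AbsRing V) rscal_norm
    (@norm_compat1 C_AbsRing V) (@norm_compat2 C_AbsRing V)
    (@norm_eq_zero C_AbsRing V).

Definition real_NormedModule : NormedModule R_AbsRing :=
  NormedModule.Pack R_AbsRing V
    (NormedModule.Class R_AbsRing V
       real_NormedModuleAux_class real_NormedModule_mixin) V.

End RealScalars.

(** * The normed algebra of bounded operators *)

Section BoundedOperators.

Context (V : NormedModule C_AbsRing).

(* [is_linear] includes boundedness. *)
Record bdop := { bdop_fun :> V -> V; bdop_linear : is_linear bdop_fun }.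

Lemma bdop_ext (A B : bdop) : (forall x, A x = B x) -> A = B.
Proof.
destruct A as [a la], B as [b lb]; simpl; intros E.
assert (a = b) as -> by (apply functional_extensionality; exact E).
now rewrite (proof_irrelevance _ la lb).
Qed.

Lemma bdop_zero_linear : is_linear (fun _ : V => zero : V).
Proof. apply is_linear_zero. Qed.

Lemma bdop_id_linear : is_linear (fun x : V => x).
Proof. apply is_linear_id. Qed.

Lemma bdop_plus_linear (A B : bdop) : is_linear (fun x => plus (A x) (B x)).
Proof.
destruct A as [a [pa sa [M [HM Ha]]]], B as [b [pb sb [N [HN Hb]]]]; simpl.
split.
- intros x y; rewrite pa, pb, <- 2!plus_assoc; apply f_equal.
  rewrite 2!plus_assoc; apply (f_equal (fun z => plus z (b y))), plus_comm.
- intros k x; rewrite sa, sb; exact (eq_sym (scal_distr_l k (a x) (b x))).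
- exists (M + N); split; [lra|]; intros x.
  apply Rle_trans with (1 := norm_triangle _ _).
  specialize (Ha x); specialize (Hb x); lra.
Qed.

Lemma bdop_scal_linear (c : C) (A : bdop) :
  is_linear (fun x => scal (K := C_AbsRing) (V := V) c (A x)).
Proof.
destruct A as [a [pa sa [M [HM Ha]]]]; simpl; split.
- intros x y; rewrite pa; exact (scal_distr_l (c : C_AbsRing) (a x) (a y)).
- intros k x; rewrite sa.
  transitivity (scal (mult c k : C_AbsRing) (a x)).
  { exact (scal_assoc (c : C_AbsRing) k (a x)). }
  transitivity (scal (mult k c : C_AbsRing) (a x)).
  { apply (f_equal (fun d => scal d (a x))); exact (Cmult_comm c k). }
  exact (eq_sym (scal_assoc (k : C_AbsRing) c (a x))).
- exists (Cmod c * M + 1); split.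
  { assert (0 <= Cmod c * M) by (apply Rmult_le_pos; [apply Cmod_ge_0|lra]); lra. }
  intros x; apply Rle_trans with (1 := norm_scal _ _).
  assert (Cmod c * norm (a x) <= Cmod c * (M * norm x))
    by (apply Rmult_le_compat_l; [apply Cmod_ge_0|apply Ha]).
  assert (0 <= norm x) by apply norm_ge_0.
  change (@abs C_AbsRing c) with (Cmod c); lra.
Qed.

Lemma bdop_comp_linear (A B : bdop) : is_linear (fun x => A (B x)).
Proof. exact (is_linear_comp _ _ (bdop_linear B) (bdop_linear A)). Qed.

Definition bdop_zero : bdop := Build_bdop bdop_zero_linear.
Definition bdop_id : bdop := Build_bdop bdop_id_linear.
Definition bdop_plus (A B : bdop) : bdop := Build_bdop (bdop_plus_linear A B).
Definition bdop_scal (c : C) (A : bdop) : bdop := Build_bdop (bdop_scal_linear c A).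
Definition bdop_opp (A : bdop) : bdop := bdop_scal (Copp (RtoC 1)) A.
Definition bdop_comp (A B : bdop) : bdop := Build_bdop (bdop_comp_linear A B).

Lemma bdop_plus_comm (A B : bdop) : bdop_plus A B = bdop_plus B A.
Proof. apply bdop_ext; intros x; simpl; apply plus_comm. Qed.

Lemma bdop_plus_assoc (A B D : bdop) :
  bdop_plus A (bdop_plus B D) = bdop_plus (bdop_plus A B) D.
Proof. apply bdop_ext; intros x; simpl; apply plus_assoc. Qed.

Lemma bdop_plus_zero (A : bdop) : bdop_plus A bdop_zero = A.
Proof. apply bdop_ext; intros x; simpl; apply plus_zero_r. Qed.

Lemma bdop_plus_opp (A : bdop) : bdop_plus A (bdop_opp A) = bdop_zero.
Proof.
apply bdop_ext; intros x; simpl.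
exact (eq_trans (f_equal (plus (A x)) (scal_opp_one (A x))) (plus_opp_r (A x))).
Qed.

Definition bdop_AbelianMonoid_mixin :=
  AbelianMonoid.Mixin bdop bdop_plus bdop_zero
    bdop_plus_comm bdop_plus_assoc bdop_plus_zero.

Canonical bdop_AbelianMonoid :=
  AbelianMonoid.Pack bdop bdop_AbelianMonoid_mixin bdop.

Definition bdop_AbelianGroup_mixin :=
  AbelianGroup.Mixin bdop_AbelianMonoid bdop_opp bdop_plus_opp.

Canonical bdop_AbelianGroup :=
  AbelianGroup.Pack bdop
    (AbelianGroup.Class bdop bdop_AbelianMonoid_mixin bdop_AbelianGroup_mixin) bdop.

Lemma bdop_scal_assoc (a b : C) (A : bdop) :
  bdop_scal a (bdop_scal b A) = bdop_scal (Cmult a b) A.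
Proof. apply bdop_ext; intros x; exact (scal_assoc a b (A x)). Qed.

Lemma bdop_scal_one (A : bdop) : bdop_scal (RtoC 1) A = A.
Proof. apply bdop_ext; intros x; exact (scal_one (A x)). Qed.

Lemma bdop_scal_plus_r (c : C) (A B : bdop) :
  bdop_scal c (bdop_plus A B) = bdop_plus (bdop_scal c A) (bdop_scal c B).
Proof. apply bdop_ext; intros x; exact (scal_distr_l c (A x) (B x)). Qed.

Lemma bdop_scal_plus_l (a b : C) (A : bdop) :
  bdop_scal (Cplus a b) A = bdop_plus (bdop_scal a A) (bdop_scal b A).
Proof. apply bdop_ext; intros x; exact (scal_distr_r a b (A x)). Qed.

Definition bdop_ModuleSpace_mixin :=
  ModuleSpace.Mixin C_AbsRing bdop_AbelianGroup bdop_scal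
    bdop_scal_assoc bdop_scal_one bdop_scal_plus_r bdop_scal_plus_l.

Canonical bdop_ModuleSpace :=
  ModuleSpace.Pack C_AbsRing bdop
    (ModuleSpace.Class C_AbsRing bdop
       (AbelianGroup.class bdop_AbelianGroup) bdop_ModuleSpace_mixin) bdop.

Definition bdop_norm (A : bdop) : R :=
  real (Lub_Rbar (fun r => exists x : V, norm x <= 1 /\ r = norm (A x))).

Lemma bdop_norm_lub (A : bdop) :
  is_lub_Rbar (fun r => exists x : V, norm x <= 1 /\ r = norm (A x))
    (bdop_norm A).
Proof.
unfold bdop_norm.
set (E := fun r => exists x : V, norm x <= 1 /\ r = norm (A x)).
assert (HL := Lub_Rbar_correct E).
destruct (linear_norm _ (bdop_linear A)) as [M [HM HA]].
assert (HE0 : E (norm (A zero))).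
{ exists zero; split; [rewrite norm_zero; lra|reflexivity]. }
assert (Hub : is_ub_Rbar E M).
{ intros r [x [Hx ->]]; simpl.
  apply Rle_trans with (1 := HA x).
  assert (0 <= norm x) by apply norm_ge_0.
  rewrite <- (Rmult_1_r M) at 2; apply Rmult_le_compat_l; lra. }
destruct HL as [H1 H2]; generalize (H1 _ HE0) (H2 _ Hub).
destruct (Lub_Rbar E) as [l| |]; simpl; try easy.
Qed.

Lemma bdop_norm_ub (A : bdop) (x : V) : norm x <= 1 -> norm (A x) <= bdop_norm A.
Proof. intros Hx; apply (proj1 (bdop_norm_lub A)); now exists x. Qed.

Lemma bdop_norm_le (A : bdop) (M : R) :
  (forall x, norm x <= 1 -> norm (A x) <= M) -> bdop_norm A <= M.
Proof.
intros H; apply (proj2 (bdop_norm_lub A) (Finite M)).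
intros r [x [Hx ->]]; exact (H x Hx).
Qed.

Lemma bdop_norm_triangle (A B : bdop) :
  bdop_norm (bdop_plus A B) <= bdop_norm A + bdop_norm B.
Proof.
apply bdop_norm_le; intros x Hx; simpl.
apply Rle_trans with (1 := norm_triangle _ _).
apply Rplus_le_compat; now apply bdop_norm_ub.
Qed.

Lemma bdop_norm_scal (c : C) (A : bdop) :
  bdop_norm (bdop_scal c A) <= Cmod c * bdop_norm A.
Proof.
apply bdop_norm_le; intros x Hx; simpl.
apply Rle_trans with (1 := norm_scal _ _).
apply Rmult_le_compat_l; [apply Cmod_ge_0|now apply bdop_norm_ub].
Qed.

Lemma bdop_norm_eq_zero (A : bdop) : bdop_norm A = 0 -> A = bdop_zero.
Proof.
intros H0; apply bdop_ext; intros x; simpl.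
assert (Hn := norm_ge_0 x).
set (t := / (norm x + 1)).
assert (Ht : 0 < t) by (apply Rinv_0_lt_compat; lra).
assert (Hx : norm (scal (RtoC t : C_AbsRing) x) <= 1).
{ apply Rle_trans with (1 := norm_scal _ _).
  change (@abs C_AbsRing (RtoC t)) with (Cmod (RtoC t)).
  rewrite Cmod_R, Rabs_pos_eq by lra.
  apply Rmult_le_reg_l with (norm x + 1); [lra|].
  unfold t; rewrite <- Rmult_assoc, Rinv_r by lra; lra. }
assert (HA := bdop_norm_ub A Hx); rewrite H0 in HA.
rewrite (linear_scal _ (bdop_linear A)) in HA.
assert (E : scal (RtoC t : C_AbsRing) (A x) = zero).
{ apply norm_eq_zero, Rle_antisym; [exact HA|apply norm_ge_0]. }
assert (Hone : mult (RtoC (/ t)) (RtoC t) = @one C_AbsRing).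
{ change (Cmult (RtoC (/ t)) (RtoC t) = RtoC 1).
  rewrite <- RtoC_mult; apply f_equal; field; lra. }
transitivity (scal (@one C_AbsRing) (A x)); [exact (eq_sym (scal_one (A x)))|].
rewrite <- Hone.
transitivity (scal (RtoC (/ t) : C_AbsRing) (scal (RtoC t : C_AbsRing) (A x))).
- exact (eq_sym (scal_assoc (RtoC (/ t) : C_AbsRing) (RtoC t) (A x))).
- rewrite E; exact (scal_zero_r (RtoC (/ t) : C_AbsRing)).
Qed.

Definition bdop_ball (A : bdop) (e : R) (B : bdop) : Prop :=
  bdop_norm (minus B A) < e.

Lemma bdop_ball_center (A : bdop) (e : posreal) : bdop_ball A e A.
Proof.
unfold bdop_ball; rewrite minus_eq_zero.
apply Rle_lt_trans with 0; [|apply cond_pos].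
apply bdop_norm_le; intros x _; change (norm (zero : V) <= 0).
rewrite norm_zero; lra.
Qed.

Lemma bdop_ball_sym (A B : bdop) (e : R) : bdop_ball A e B -> bdop_ball B e A.
Proof.
unfold bdop_ball; apply Rle_lt_trans.
rewrite <- opp_minus.
apply Rle_trans with (1 := bdop_norm_scal (Copp (RtoC 1)) (minus B A)).
rewrite Cmod_opp, Cmod_1; lra.
Qed.

Lemma bdop_ball_triangle (A B D : bdop) (e1 e2 : R) :
  bdop_ball A e1 B -> bdop_ball B e2 D -> bdop_ball A (e1 + e2) D.
Proof.
unfold bdop_ball; intros H1 H2; rewrite (minus_trans B).
apply Rle_lt_trans with (1 := bdop_norm_triangle (minus D B) (minus B A)); lra.
Qed.

Definition bdop_UniformSpace_mixin :=
  UniformSpace.Mixin bdop bdop_zero bdop_ball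
    bdop_ball_center bdop_ball_sym bdop_ball_triangle.

Canonical bdop_UniformSpace := UniformSpace.Pack bdop bdop_UniformSpace_mixin bdop.

Definition bdop_NormedModuleAux_class : NormedModuleAux.class_of C_AbsRing bdop :=
  NormedModuleAux.Class C_AbsRing bdop
    (ModuleSpace.class C_AbsRing bdop_ModuleSpace) bdop_UniformSpace_mixin.

Canonical bdop_NormedModuleAux :=
  NormedModuleAux.Pack C_AbsRing bdop bdop_NormedModuleAux_class bdop.

Lemma bdop_norm_compat1 (A B : bdop) (e : R) :
  bdop_norm (minus B A) < e -> bdop_ball A e B.
Proof. easy. Qed.

Lemma bdop_norm_compat2 (A B : bdop) (e : posreal) :
  bdop_ball A e B -> bdop_norm (minus B A) < 1 * e.
Proof. now rewrite Rmult_1_l. Qed.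

Definition bdop_NormedModule_mixin :=
  NormedModule.Mixin C_AbsRing bdop_NormedModuleAux bdop_norm 1
    bdop_norm_triangle bdop_norm_scal bdop_norm_compat1 bdop_norm_compat2
    bdop_norm_eq_zero.

Canonical bdop_NormedModule :=
  NormedModule.Pack C_AbsRing bdop
    (NormedModule.Class C_AbsRing bdop
       bdop_NormedModuleAux_class bdop_NormedModule_mixin) bdop.

End BoundedOperators.

(** * Adjoint, inverse, spectrum

    [adjoint] and [inverse] select an operator that is unique when it exists;
    the adjoint always exists, by the Riesz representation theorem. *)

Definition is_adjoint (H : Hilbert) (A B : bdop H) : Prop :=
  forall x y : H, inner (A x) y = inner x (B y).

Definition adjoint (H : Hilbert) (A : bdop H) : bdop H :=
  epsilon (inhabits zero) (is_adjoint A).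

Definition is_inverse (V : NormedModule C_AbsRing) (A B : bdop V) : Prop :=
  bdop_comp A B = bdop_id V /\ bdop_comp B A = bdop_id V.

Definition inverse (V : NormedModule C_AbsRing) (A : bdop V) : bdop V :=
  epsilon (inhabits zero) (is_inverse A).

Definition spectrum (V : NormedModule C_AbsRing) (A : bdop V) (z : C) : Prop :=
  ~ exists B, is_inverse (minus (scal (K := C_AbsRing) z (bdop_id V)) A) B.

Definition resolvent (V : NormedModule C_AbsRing) (A : bdop V) (z : C) : bdop V :=
  inverse (minus (scal (K := C_AbsRing) z (bdop_id V)) A).

(** * Cycles and contour integrals

    Paths are parametrized by [0, 1], as restrictions of C^1 maps on the whole
    line. The velocity may vanish, so that piecewise C^1 paths are covered, up
    to a reparametrization that stops at the corners. *)

Record closed_path := {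
  path :> R -> C;
  velocity : R -> C;
  path_derive : forall t : R,
    is_derive (K := R_AbsRing) (V := C_R_NormedModule) path t (velocity t);
  velocity_continuous : forall t : R,
    continuous (U := C_UniformSpace) velocity t;
  path_closed : path 0 = path 1
}.

(* A formal sum of closed paths. *)
Definition cycle := list closed_path.

(* [v] is the integral of [F z dz] along the cycle; all paths have the same
   parameter interval, so the integrands are summed. *)
Definition is_cycle_int (V : NormedModule C_AbsRing) (Gamma : cycle)
    (F : C -> V) (v : V) : Prop :=
  is_RInt (V := real_NormedModule V)
    (fun t => fold_right plus zero
       (map (fun gamma =>
              scal (K := C_AbsRing) (velocity gamma t) (F (gamma t))) Gamma))
    0 1 v.

Definition is_winding (Gamma : cycle) (z : C) (n : C) : Prop :=
  is_cycle_int (V := C_NormedModule) Gamma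
    (fun zeta => Cinv (2 * PI * Ci * (zeta - z))%C) n.

Definition surrounds (Gamma : cycle) (K Omega : C -> Prop) : Prop :=
  (forall gamma, In gamma Gamma -> forall t, 0 <= t <= 1 ->
     Omega (gamma t) /\ ~ K (gamma t)) /\
  (forall z, K z -> is_winding Gamma z (RtoC 1)) /\
  (forall z, ~ Omega z -> is_winding Gamma z (RtoC 0)).

(* f(A): by Cauchy's theorem the value does not depend on the cycle. *)
Definition hol_calc (V : NormedModule C_AbsRing) (Omega : C -> Prop)
    (f : C -> C) (A : bdop V) : bdop V :=
  epsilon (inhabits zero) (fun B =>
    exists Gamma, surrounds Gamma (spectrum A) Omega /\
      is_cycle_int Gamma
        (fun zeta =>
           scal (K := C_AbsRing) (f zeta / (2 * PI * Ci))%C (resolvent A zeta))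
        B).

(** * The algebra A(Omega) *)

Definition bounded_set (Omega : C -> Prop) : Prop :=
  exists M : R, forall z, Omega z -> Cmod z <= M.

Definition closure (Omega : C -> Prop) (z : C) : Prop :=
  forall eps : R, 0 < eps -> exists w, Omega w /\ Cmod (w - z)%C < eps.

(* Functions are total on [C]; only their values on the closure matter. *)
Definition in_A (Omega : C -> Prop) (f : C -> C) : Prop :=
  continuous_on (T := C_UniformSpace) (U := C_UniformSpace) (closure Omega) f /\
  forall z, Omega z -> ex_derive (K := C_AbsRing) (V := C_NormedModule) f z.

Definition sup_norm (Omega : C -> Prop) (f : C -> C) : R :=
  real (Lub_Rbar (fun r => exists z, Omega z /\ r = Cmod (f z))).

(* Main.v *)
Require Import Defs.
From Stdlib Require Import Reals Lra List ClassicalEpsilon.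
From Coquelicot Require Import Coquelicot.
Set Implicit Arguments.
Unset Strict Implicit.

Open Scope R_scope.

(** The operator is [T = 2 P - 2 (1 - P)] on [C^2], where [P] is the oblique
    projection with matrix [[1, 1], [0, 0]], and [Omega] consists of two disjoint
    squares around the eigenvalues [2] and [-2]. With [a = f 2] and [b = f (-2)],
    the operator [f(T) = a P + b (1 - P)] has matrix [[a, a - b], [0, b]]
    ([oblique_hol_calc]).

    For the first property, take for [g] the locally constant function with
    values [- conj a] and [- conj b]: then [f(T) + g(T)^*] is the matrix
    [[0, a - b], [b - a, 0]], of norm [|a - b| <= 2 |f|] ([skew_norm]). For the
    second, the locally constant [f] with values [1] and [-1] gives
    [f(T) = 2 P - 1], whose norm is [1 + sqrt 2] because the range and the kernel
    of [P] make an angle of [PI / 4] ([reflection_norm]).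

    What takes work is to evaluate [f(T)] for every function of the algebra and
    every admissible cycle, that is, Cauchy's formula for functions that are only
    known to be differentiable ([Cauchy_formula]). Goursat's lemma, proved by
    bisection of rectangles, yields a primitive on a square for every continuous
    function that is holomorphic except perhaps at the centre
    ([square_primitive]). The primitives on the two squares together form one on
    [Omega], so the integral of such a function along any cycle in [Omega]
    vanishes. Applied to the difference quotients of [f] at the eigenvalues this
    is Cauchy's formula, which gives the Cauchy integral of the resolvent
    [P / (z - 2) + (1 - P) / (z + 2)]. *)

(** * Bisection of rectangles *)

Lemma nested_intervals (a b : nat -> R) :
  (forall n, a n <= a (S n)) -> (forall n, b (S n) <= b n) ->
  (forall n, a n <= b n) -> exists x, forall n, a n <= x <= b n.
Proof.
intros Ha Hb Hab.
assert (Ha' : forall n m, a n <= a (n + m)%nat).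
{ intros n m; induction m as [|m IH]; [rewrite Nat.add_0_r; lra|].
  rewrite Nat.add_succ_r; specialize (Ha (n + m)%nat); lra. }
assert (Hb' : forall n m, b (n + m)%nat <= b n).
{ intros n m; induction m as [|m IH]; [rewrite Nat.add_0_r; lra|].
  rewrite Nat.add_succ_r; specialize (Hb (n + m)%nat); lra. }
assert (H : forall n m, a m <= b n).
{ intros n m; specialize (Ha' m n); specialize (Hb' n m); specialize (Hab (m + n)%nat).
  rewrite (Nat.add_comm n m) in Hb'; lra. }
destruct (completeness (fun r => exists n, r = a n)) as [x [H1 H2]].
- exists (b O); intros r [n ->]; apply H.
- now exists (a O), O.
- exists x; intros n; split; [apply H1; now exists n|].
  apply H2; intros r [m ->]; apply H.
Qed.

(** An induction principle in the style of Cousin's lemma: a property of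
    rectangles that passes from the four quadrants to the whole, and that holds
    for all small enough subrectangles around each point, holds for the given
    rectangle. Otherwise, quartering would give nested rectangles without the
    property, and they shrink to a point. It serves twice: for Goursat's lemma
    and for the boundedness of continuous functions. *)
Lemma rectangle_ind (P : R -> R -> R -> R -> Prop) (a0 b0 c0 d0 : R) :
  a0 <= b0 -> c0 <= d0 ->
  (forall a b c d, a0 <= a <= b -> b <= b0 -> c0 <= c <= d -> d <= d0 ->
     let m := (a + b) / 2 in let n := (c + d) / 2 in
     P a m c n -> P m b c n -> P a m n d -> P m b n d -> P a b c d) ->
  (forall x y, a0 <= x <= b0 -> c0 <= y <= d0 -> exists delta, 0 < delta /\
     forall a b c d, a0 <= a <= x -> x <= b <= b0 -> c0 <= c <= y -> y <= d <= d0 ->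
       b - a < delta -> d - c < delta -> P a b c d) ->
  P a0 b0 c0 d0.
Proof.
intros Hab Hcd Hquad Hloc; apply NNPP; intros Hbad.
pose (bad := fun r : (R * R) * (R * R) =>
  let '((a, b), (c, d)) := r in
  a0 <= a <= b /\ b <= b0 /\ c0 <= c <= d /\ d <= d0 /\ ~ P a b c d).
assert (step : forall r : sig bad, exists r' : sig bad,
  let '((a, b), (c, d)) := proj1_sig r in
  let '((a', b'), (c', d')) := proj1_sig r' in
  a <= a' /\ b' <= b /\ c <= c' /\ d' <= d /\
  b' - a' = (b - a) / 2 /\ d' - c' = (d - c) / 2).
{ intros [[[a b] [c d]] [H1 [H2 [H3 [H4 H5]]]]]; simpl.
  apply NNPP; intros Hno; apply H5; apply Hquad; try assumption; apply NNPP; intros HP; apply Hno.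
  - assert (Hb : bad ((a, (a + b) / 2), (c, (c + d) / 2))) by (repeat split; try assumption; lra).
    exists (exist bad _ Hb); simpl; repeat split; lra.
  - assert (Hb : bad (((a + b) / 2, b), (c, (c + d) / 2))) by (repeat split; try assumption; lra).
    exists (exist bad _ Hb); simpl; repeat split; lra.
  - assert (Hb : bad ((a, (a + b) / 2), ((c + d) / 2, d))) by (repeat split; try assumption; lra).
    exists (exist bad _ Hb); simpl; repeat split; lra.
  - assert (Hb : bad (((a + b) / 2, b), ((c + d) / 2, d))) by (repeat split; try assumption; lra).
    exists (exist bad _ Hb); simpl; repeat split; lra. }
destruct (choice _ step) as [next Hnext].
assert (Hb : bad ((a0, b0), (c0, d0))) by (repeat split; try assumption; lra).
pose (u := fix u n := match n with O => exist bad _ Hb | S n => next (u n) end).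
pose (al := fun n => fst (fst (proj1_sig (u n)))).
pose (be := fun n => snd (fst (proj1_sig (u n)))).
pose (ga := fun n => fst (snd (proj1_sig (u n)))).
pose (de := fun n => snd (snd (proj1_sig (u n)))).
assert (Hu : forall n, a0 <= al n <= be n /\ be n <= b0 /\ c0 <= ga n <= de n /\
  de n <= d0 /\ ~ P (al n) (be n) (ga n) (de n)).
{ intros n; unfold al, be, ga, de; destruct (u n) as [[[a b] [c d]] H]; exact H. }
assert (Hs : forall n, al n <= al (S n) /\ be (S n) <= be n /\
  ga n <= ga (S n) /\ de (S n) <= de n /\
  be (S n) - al (S n) = (be n - al n) / 2 /\ de (S n) - ga (S n) = (de n - ga n) / 2).
{ intros n; unfold al, be, ga, de; simpl u; generalize (Hnext (u n)).
  destruct (proj1_sig (u n)) as [[a b] [c d]].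
  destruct (proj1_sig (next (u n))) as [[a' b'] [c' d']]; easy. }
destruct (nested_intervals (a := al) (b := be)) as [x Hx]; try apply Hs; [intros n; apply Hu|].
destruct (nested_intervals (a := ga) (b := de)) as [y Hy]; try apply Hs; [intros n; apply Hu|].
destruct (Hloc x y) as [delta [Hd HP]]; [generalize (Hx O) | generalize (Hy O) |].
{ unfold al, be; simpl; lra. }
{ unfold ga, de; simpl; lra. }
assert (Hw : forall n, be n - al n = (b0 - a0) * (/ 2) ^ n).
{ induction n as [|n IH]; [unfold al, be; simpl; lra|].
  destruct (Hs n) as [_ [_ [_ [_ [-> _]]]]]; rewrite IH; simpl; field. }
assert (Hh : forall n, de n - ga n = (d0 - c0) * (/ 2) ^ n).
{ induction n as [|n IH]; [unfold ga, de; simpl; lra|].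
  destruct (Hs n) as [_ [_ [_ [_ [_ ->]]]]]; rewrite IH; simpl; field. }
destruct (pow_lt_1_zero (/ 2)) with (y := delta / (b0 - a0 + (d0 - c0) + 1)) as [N HN].
{ rewrite Rabs_pos_eq; lra. }
{ apply Rdiv_lt_0_compat; lra. }
specialize (HN N (le_n N)).
assert (H2 : 0 < (/ 2) ^ N) by (apply pow_lt; lra).
rewrite Rabs_pos_eq in HN by lra.
apply Rmult_lt_compat_r with (r := b0 - a0 + (d0 - c0) + 1) in HN; [|lra].
unfold Rdiv in HN; rewrite Rmult_assoc, Rinv_l, Rmult_1_r in HN by lra.
assert (0 <= (b0 - a0) * (/ 2) ^ N) by (apply Rmult_le_pos; lra).
assert (0 <= (d0 - c0) * (/ 2) ^ N) by (apply Rmult_le_pos; lra).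
destruct (Hu N) as [U1 [U2 [U3 [U4 U5]]]]; apply U5.
specialize (Hx N); specialize (Hy N).
apply HP; try lra; [rewrite Hw | rewrite Hh]; lra.
Qed.

(** * Continuity and derivatives in terms of the modulus *)

Lemma Cmod_le_abs (z : C) : Cmod z <= Rabs (fst z) + Rabs (snd z).
Proof.
destruct z as [x y]; simpl.
replace ((x, y) : C) with (Cplus (RtoC x) (Cmult Ci (RtoC y))) by
  (unfold Cplus, Cmult, RtoC, Ci; simpl; f_equal; ring).
apply Rle_trans with (1 := Cmod_triangle _ _).
rewrite Cmod_mult, Cmod_Ci, 2!Cmod_R; simpl; lra.
Qed.

Lemma Cmod_lt_ball (z w : C) (e : R) : Cmod (w - z)%C < e -> ball (M := C_UniformSpace) z e w.
Proof. exact (C_NormedModule_mixin_compat1 z w e). Qed.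

Lemma ball_lt_Cmod (z w : C) (e : R) :
  ball (M := C_UniformSpace) z (e / 2) w -> Cmod (w - z)%C < e.
Proof.
intros [H1 H2].
apply Rle_lt_trans with (1 := Cmod_le_abs _).
replace e with (e / 2 + e / 2) by field.
apply Rplus_lt_compat; [exact H1 | exact H2].
Qed.

Lemma locally_Cmod (z : C) (P : C -> Prop) :
  locally (T := C_UniformSpace) z P <->
  exists delta, 0 < delta /\ forall w, Cmod (w - z)%C < delta -> P w.
Proof.
split.
- intros [e He]; exists e; split; [apply cond_pos|].
  intros w Hw; apply He, Cmod_lt_ball, Hw.
- intros [d [Hd H]].
  assert (Hd2 : 0 < d / 2) by lra.
  exists (mkposreal _ Hd2); intros w Hw; apply H, ball_lt_Cmod, Hw.
Qed.

(** The uniform structure on [C] is that of the product of two lines, so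
    limits have to be translated once and for all to the modulus. *)
Lemma filterlim_Cmod (F : (C -> Prop) -> Prop) {FF : Filter F} (f : C -> C) (l : C) :
  filterlim f F (locally (T := C_UniformSpace) l) <->
  forall eps, 0 < eps -> F (fun w => Cmod (f w - l)%C < eps).
Proof.
split.
- intros H eps Heps.
  assert (He : 0 < eps / 2) by lra.
  apply (filter_imp (fun w => ball (M := C_UniformSpace) l (eps / 2) (f w))).
  { intros w; apply ball_lt_Cmod. }
  apply H; exists (mkposreal _ He); now intros.
- intros H P [e He]; specialize (H e (cond_pos e)).
  unfold filtermap; apply (filter_imp (fun w => Cmod (f w - l)%C < e)); [|exact H].
  intros w Hw; apply He, Cmod_lt_ball, Hw.
Qed.

Notation ccontinuous := (continuous (T := C_UniformSpace) (U := C_UniformSpace)).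
Notation is_cderive := (is_derive (K := C_AbsRing) (V := C_NormedModule)).
Notation ex_cderive := (ex_derive (K := C_AbsRing) (V := C_NormedModule)).

Lemma ccontinuous_Cmod (f : C -> C) (z : C) :
  ccontinuous f z <->
  forall eps, 0 < eps -> exists delta, 0 < delta /\
    forall w, Cmod (w - z)%C < delta -> Cmod (f w - f z)%C < eps.
Proof.
unfold continuous; rewrite filterlim_Cmod by apply locally_filter.
split; intros H eps Heps; apply locally_Cmod, H, Heps.
Qed.

Lemma is_cderive_Cmod (f : C -> C) (z l : C) :
  is_cderive f z l <->
  forall eps, 0 < eps -> exists delta, 0 < delta /\
    forall w, Cmod (w - z)%C < delta ->
      Cmod (f w - f z - (w - z) * l)%C <= eps * Cmod (w - z)%C.
Proof.
split.
- intros [_ H] eps Heps.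
  destruct (H z (fun P HP => HP) (mkposreal eps Heps)) as [d Hd].
  exists d; split; [apply cond_pos|]; exact Hd.
- intros H; split; [apply is_linear_scal_l|].
  intros z' Hz' eps.
  apply (is_filter_lim_locally_unique (V := AbsRing_NormedModule C_AbsRing) z z') in Hz'; subst z'.
  destruct (H eps (cond_pos eps)) as [d [Hd Hw]].
  exists (mkposreal d Hd); exact Hw.
Qed.

Lemma is_cderive_continuous (f : C -> C) (z l : C) : is_cderive f z l -> ccontinuous f z.
Proof.
rewrite is_cderive_Cmod, ccontinuous_Cmod; intros H eps Heps.
destruct (H 1) as [d [Hd Hw]]; [lra|].
assert (Hl := Cmod_ge_0 l).
exists (Rmin d (eps / (2 + Cmod l))); split.
{ apply Rmin_pos; [exact Hd | apply Rdiv_lt_0_compat; lra]. }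
intros w Hwd.
assert (H1 : Cmod (w - z)%C < d) by (apply Rlt_le_trans with (1 := Hwd), Rmin_l).
assert (H2 : Cmod (w - z)%C < eps / (2 + Cmod l))
  by (apply Rlt_le_trans with (1 := Hwd), Rmin_r).
specialize (Hw w H1).
replace (f w - f z)%C with ((f w - f z - (w - z) * l) + (w - z) * l)%C by ring.
apply Rle_lt_trans with (1 := Cmod_triangle _ _); rewrite Cmod_mult.
apply Rmult_lt_compat_r with (r := 2 + Cmod l) in H2; [|lra].
replace (eps / (2 + Cmod l) * (2 + Cmod l)) with eps in H2 by (field; lra).
assert (0 <= Cmod (w - z)%C) by apply Cmod_ge_0; lra.
Qed.

(** The product structure and the one induced by the modulus have the same
    neighbourhoods but are distinct as uniform spaces; the continuity of the
    multiplication of an absolute ring refers to the second. *)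
Lemma continuous_Cmult (T : UniformSpace) (f g : T -> C) (x : T) :
  continuous (U := C_UniformSpace) f x -> continuous (U := C_UniformSpace) g x ->
  continuous (U := C_UniformSpace) (fun t => (f t * g t)%C) x.
Proof.
assert (E : forall (h : T -> C) l, filterlim h (locally x) (locally (T := C_UniformSpace) l) <->
  filterlim h (locally x) (locally (T := AbsRing_UniformSpace C_AbsRing) l)).
{ intros h l; split; intros H P HP; apply H, locally_C, HP. }
unfold continuous; rewrite 3!E; apply (continuous_mult (K := C_AbsRing)).
Qed.

(** * Integrals along the boundary of a rectangle *)

Notation CRInt := (RInt (V := C_R_CompleteNormedModule)).
Notation ex_CRInt := (ex_RInt (V := C_R_CompleteNormedModule)).
Notation is_CRInt := (is_RInt (V := C_R_CompleteNormedModule)).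

Definition side_int_h (f : C -> C) (y a b : R) : C := CRInt (fun x => f (x, y)) a b.

(** On a vertical side [dz = i dy]. *)
Definition side_int_v (f : C -> C) (x c d : R) : C := (Ci * CRInt (fun y => f (x, y)) c d)%C.
Definition boundary_int (f : C -> C) (a b c d : R) : C :=
  (side_int_h f c a b + side_int_v f b c d - side_int_h f d a b - side_int_v f a c d)%C.

Definition convex_R (D : R -> Prop) : Prop :=
  forall a b x, D a -> D b -> Rmin a b <= x <= Rmax a b -> D x.

Lemma CRInt_bound (f : R -> C) (a b M : R) :
  ex_CRInt f a b -> (forall x, Rmin a b <= x <= Rmax a b -> Cmod (f x) <= M) ->
  Cmod (CRInt f a b) <= Rabs (b - a) * M.
Proof.
intros Hf HM; rewrite Cmod_norm.
apply (norm_RInt_le_const_abs (V := C_R_CompleteNormedModule) f a b).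
- intros x Hx; rewrite <- Cmod_norm; now apply HM.
- apply RInt_correct, Hf.
Qed.

Section Product.

Variables (D1 D2 : R -> Prop) (f : C -> C).
Hypotheses (H1 : convex_R D1) (H2 : convex_R D2).
Hypothesis Hf : forall x y, D1 x -> D2 y -> ccontinuous f (x, y).

Lemma ex_side_int_h (y a b : R) : D2 y -> D1 a -> D1 b -> ex_CRInt (fun x => f (x, y)) a b.
Proof.
intros Hy Ha Hb; apply ex_RInt_continuous; intros x Hx.
apply (continuous_comp (U := R_UniformSpace) (V := C_UniformSpace) (fun x => (x, y)) f).
- intros P [e He]; exists e; intros x' Hx'; apply He; split; [exact Hx' | apply ball_center].
- apply Hf; [apply (H1 Ha Hb Hx) | exact Hy].
Qed.

Lemma ex_side_int_v (x c d : R) : D1 x -> D2 c -> D2 d -> ex_CRInt (fun y => f (x, y)) c d.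
Proof.
intros Hx Hc Hd; apply ex_RInt_continuous; intros y Hy.
apply (continuous_comp (U := R_UniformSpace) (V := C_UniformSpace) (fun y => (x, y)) f).
- intros P [e He]; exists e; intros y' Hy'; apply He; split; [apply ball_center | exact Hy'].
- apply Hf; [exact Hx | apply (H2 Hc Hd Hy)].
Qed.

Lemma side_int_h_Chasles (y a b c : R) : D2 y -> D1 a -> D1 b -> D1 c ->
  (side_int_h f y a b + side_int_h f y b c)%C = side_int_h f y a c.
Proof.
intros; apply (RInt_Chasles (V := C_R_CompleteNormedModule)); now apply ex_side_int_h.
Qed.

Lemma side_int_v_Chasles (x a b c : R) : D1 x -> D2 a -> D2 b -> D2 c ->
  (side_int_v f x a b + side_int_v f x b c)%C = side_int_v f x a c.
Proof.
intros; unfold side_int_v; rewrite <- Cmult_plus_distr_l; f_equal.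
apply (RInt_Chasles (V := C_R_CompleteNormedModule)); now apply ex_side_int_v.
Qed.

Lemma boundary_int_split_h (a m b c d : R) :
  D1 a -> D1 m -> D1 b -> D2 c -> D2 d ->
  boundary_int f a b c d = (boundary_int f a m c d + boundary_int f m b c d)%C.
Proof.
intros; unfold boundary_int.
rewrite <- (side_int_h_Chasles (y := c) (a := a) (b := m) (c := b)) by assumption.
rewrite <- (side_int_h_Chasles (y := d) (a := a) (b := m) (c := b)) by assumption.
ring.
Qed.

Lemma boundary_int_split_v (a b c n d : R) :
  D1 a -> D1 b -> D2 c -> D2 n -> D2 d ->
  boundary_int f a b c d = (boundary_int f a b c n + boundary_int f a b n d)%C.
Proof.
intros; unfold boundary_int.
rewrite <- (side_int_v_Chasles (x := a) (a := c) (b := n) (c := d)) by assumption.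
rewrite <- (side_int_v_Chasles (x := b) (a := c) (b := n) (c := d)) by assumption.
ring.
Qed.

Lemma boundary_int_split (a m b c n d : R) :
  D1 a -> D1 m -> D1 b -> D2 c -> D2 n -> D2 d ->
  boundary_int f a b c d =
    (boundary_int f a m c n + boundary_int f m b c n +
     boundary_int f a m n d + boundary_int f m b n d)%C.
Proof.
intros; rewrite (boundary_int_split_v (c := c) (n := n) (d := d)) by assumption.
rewrite (boundary_int_split_h (a := a) (m := m) (b := b) (c := c)) by assumption.
rewrite (boundary_int_split_h (a := a) (m := m) (b := b) (c := n)) by assumption.
ring.
Qed.

Lemma side_int_h_bound (y a b M : R) : D2 y -> D1 a -> D1 b ->
  (forall x, Rmin a b <= x <= Rmax a b -> Cmod (f (x, y)) <= M) ->
  Cmod (side_int_h f y a b) <= Rabs (b - a) * M.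
Proof. intros; apply CRInt_bound; [now apply ex_side_int_h | assumption]. Qed.

Lemma side_int_v_bound (x c d M : R) : D1 x -> D2 c -> D2 d ->
  (forall y, Rmin c d <= y <= Rmax c d -> Cmod (f (x, y)) <= M) ->
  Cmod (side_int_v f x c d) <= Rabs (d - c) * M.
Proof.
intros; unfold side_int_v; rewrite Cmod_mult, Cmod_Ci, Rmult_1_l.
apply CRInt_bound; [now apply ex_side_int_v | assumption].
Qed.

Lemma boundary_int_bound (a b c d M : R) : D1 a -> D1 b -> D2 c -> D2 d ->
  (forall x y, Rmin a b <= x <= Rmax a b -> Rmin c d <= y <= Rmax c d ->
     Cmod (f (x, y)) <= M) ->
  Cmod (boundary_int f a b c d) <= 2 * (Rabs (b - a) + Rabs (d - c)) * M.
Proof.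
intros Ha Hb Hc Hd HM.
assert (Ea : Rmin a b <= a <= Rmax a b) by (split; [apply Rmin_l | apply Rmax_l]).
assert (Eb : Rmin a b <= b <= Rmax a b) by (split; [apply Rmin_r | apply Rmax_r]).
assert (Ec : Rmin c d <= c <= Rmax c d) by (split; [apply Rmin_l | apply Rmax_l]).
assert (Ed : Rmin c d <= d <= Rmax c d) by (split; [apply Rmin_r | apply Rmax_r]).
unfold boundary_int, Cminus.
apply Rle_trans with (1 := Cmod_triangle _ _).
apply Rle_trans with (1 := Rplus_le_compat_r _ _ _ (Cmod_triangle _ _)).
apply Rle_trans with (1 := Rplus_le_compat_r _ _ _ (Rplus_le_compat_r _ _ _ (Cmod_triangle _ _))).
rewrite 2!Cmod_opp.
assert (K1 := side_int_h_bound (y := c) (a := a) (b := b) (M := M) Hc Ha Hb (fun x Hx => HM x c Hx Ec)).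
assert (K2 := side_int_h_bound (y := d) (a := a) (b := b) (M := M) Hd Ha Hb (fun x Hx => HM x d Hx Ed)).
assert (K3 := side_int_v_bound (x := a) (c := c) (d := d) (M := M) Ha Hc Hd (fun y Hy => HM a y Ea Hy)).
assert (K4 := side_int_v_bound (x := b) (c := c) (d := d) (M := M) Hb Hc Hd (fun y Hy => HM b y Eb Hy)).
lra.
Qed.

End Product.

(** * Integrals and derivatives along paths *)

Lemma Riemann_sum_linear (U V : NormedModule R_AbsRing) (L : U -> V) (f : R -> U) (ptd : SF_seq) :
  is_linear L -> Riemann_sum (fun t => L (f t)) ptd = L (Riemann_sum f ptd).
Proof.
intros HL; pattern ptd; apply SF_cons_ind.
- intros x0; change ((zero : V) = L zero).
  now rewrite (linear_zero L HL).
- intros h s IH; rewrite 2!Riemann_sum_cons, IH.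
  now rewrite (linear_plus L HL), (linear_scal L HL).
Qed.

Lemma is_RInt_linear (U V : NormedModule R_AbsRing) (L : U -> V) (f : R -> U) (a b : R) (v : U) :
  is_linear L -> is_RInt f a b v -> is_RInt (fun t => L (f t)) a b (L v).
Proof.
intros HL Hf; unfold is_RInt.
apply (filterlim_ext (fun ptd => L (scal (sign (b - a)) (Riemann_sum f ptd)))).
{ intros ptd; rewrite (Riemann_sum_linear f ptd HL); exact (linear_scal L HL _ _). }
apply (filterlim_comp _ _ _ (fun ptd => scal (sign (b - a)) (Riemann_sum f ptd)) L
  _ (locally v)); [exact Hf|].
apply linear_cont, HL.
Qed.

Lemma is_RInt_value_unique (V : NormedModule R_AbsRing) (f : R -> V) (a b : R) (u v : V) :
  is_RInt f a b u -> is_RInt f a b v -> u = v.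
Proof.
apply filterlim_locally_unique.
Qed.

Lemma is_linear_Cmult (c : C) :
  is_linear (U := C_R_NormedModule) (V := C_R_NormedModule) (fun z => (c * z)%C).
Proof.
split.
- intros x y; exact (Cmult_plus_distr_l c x y).
- intros k [x y]; destruct c as [c1 c2]; unfold scal; simpl; unfold prod_scal, scal; simpl.
  unfold Cmult, mult; simpl; f_equal; ring.
- exists (Cmod c + 1); split; [generalize (Cmod_ge_0 c); lra|].
  intros z; rewrite <- 2!Cmod_norm, Cmod_mult.
  assert (0 <= Cmod z) by apply Cmod_ge_0; lra.
Qed.

(** Complex scalars are not scalars of the real module in which paths are
    integrated, but multiplication by one is a real linear map. *)
Lemma CRInt_Cmult (c : C) (f : R -> C) (a b : R) :
  ex_CRInt f a b -> CRInt (fun t => (c * f t)%C) a b = (c * CRInt f a b)%C.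
Proof.
intros Hf; apply (is_RInt_unique (V := C_R_CompleteNormedModule)).
apply (is_RInt_linear (is_linear_Cmult c)), (RInt_correct (V := C_R_CompleteNormedModule)), Hf.
Qed.

Notation is_path_derive := (is_derive (K := R_AbsRing) (V := C_R_NormedModule)).

(** The chain rule for a real variable inside a complex one: the complex
    derivative of [F] is read as a real linear map. *)
Lemma is_path_derive_comp (F : C -> C) (gamma : R -> C) (t : R) (v l : C) :
  is_path_derive gamma t v -> is_cderive F (gamma t) l ->
  is_path_derive (fun s => F (gamma s)) t (v * l)%C.
Proof.
intros Hg HF.
assert (HF' : filterdiff (K := R_AbsRing) (U := C_R_NormedModule) (V := C_R_NormedModule)
  F (locally (gamma t)) (fun z => (l * z)%C)).
{ split; [apply is_linear_Cmult|].
  intros z Hz eps.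
  apply (is_filter_lim_locally_unique (V := C_R_NormedModule) (gamma t) z) in Hz; subst z.
  apply locally_Cmod.
  destruct (proj1 (is_cderive_Cmod _ _ _) HF eps (cond_pos eps)) as [d [Hd H]].
  exists d; split; [exact Hd|]; intros w Hw; rewrite <- 2!Cmod_norm.
  specialize (H w Hw); rewrite Cmult_comm in H; exact H. }
apply (filterdiff_ext_lin _ (fun s => (l * scal (K := R_AbsRing) (V := C_R_NormedModule) s v)%C)).
- apply (filterdiff_comp (U := R_NormedModule) (V := C_R_NormedModule) (W := C_R_NormedModule)
    gamma F (fun s => scal (K := R_AbsRing) (V := C_R_NormedModule) s v) (fun z => (l * z)%C) Hg).
  destruct HF' as [HL HD]; split; [exact HL|].
  intros z Hz.
  assert (E : gamma t = z).
  { apply (is_filter_lim_unique (V := C_R_NormedModule) (F := filtermap gamma (locally t)));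
      [|exact Hz].
    apply (ex_derive_continuous (K := R_AbsRing) (V := C_R_NormedModule) gamma t).
    now exists v. }
  subst z; intros eps.
  apply (ex_derive_continuous (K := R_AbsRing) (V := C_R_NormedModule) gamma t).
  { now exists v. }
  apply HD; intros P HP; exact HP.
- intros s; rewrite (Cmult_comm v l).
  exact (linear_scal _ (is_linear_Cmult l) s v).
Qed.

Lemma is_path_derive_affine (p v : C) (t : R) :
  is_path_derive (fun s => (p + RtoC s * v)%C) t v.
Proof.
apply (is_derive_ext (fun s => plus (p : C_R_NormedModule) (scal (K := R_AbsRing) (s : R_AbsRing) (v : C_R_NormedModule)))).
{ intros s; destruct v as [v1 v2], p as [p1 p2]; unfold plus, scal; simpl.
  unfold prod_plus, prod_scal, plus, scal, Cplus, Cmult; simpl; unfold mult; simpl.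
  f_equal; ring. }
assert (D : is_path_derive (fun s => plus (p : C_R_NormedModule)
    (scal (K := R_AbsRing) (s : R_AbsRing) (v : C_R_NormedModule))) t
    (plus (zero : C_R_NormedModule) (scal (K := R_AbsRing) (one : R_AbsRing) (v : C_R_NormedModule)))).
{ apply (is_derive_plus (K := R_AbsRing) (V := C_R_NormedModule)).
  - apply is_derive_const.
  - apply (is_derive_scal_l (K := R_AbsRing) (V := C_R_NormedModule) (fun s => s)), is_derive_id. }
rewrite plus_zero_l in D.
rewrite (scal_one (K := R_AbsRing) (V := C_R_NormedModule) v) in D; exact D.
Qed.

Lemma is_path_derive_h (x y : R) : is_path_derive (fun t => (t, y) : C) x (RtoC 1).
Proof.
apply (is_derive_ext (V := C_R_NormedModule) (fun s => ((0, y) + RtoC s * 1)%C)); [|apply is_path_derive_affine].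
intros s; unfold Cplus, Cmult, RtoC; simpl; f_equal; ring.
Qed.

Lemma is_path_derive_v (x y : R) : is_path_derive (fun t => (x, t) : C) y Ci.
Proof.
apply (is_derive_ext (V := C_R_NormedModule) (fun s => ((x, 0) + RtoC s * Ci)%C)); [|apply is_path_derive_affine].
intros s; unfold Cplus, Cmult, RtoC, Ci; simpl; f_equal; ring.
Qed.

Lemma CRInt_primitive (F f : C -> C) (gamma : R -> C) (v : R -> C) (a b : R) :
  (forall t, Rmin a b <= t <= Rmax a b -> is_path_derive gamma t (v t)) ->
  (forall t, Rmin a b <= t <= Rmax a b -> continuous (U := C_UniformSpace) v t) ->
  (forall t, Rmin a b <= t <= Rmax a b -> is_cderive F (gamma t) (f (gamma t))) ->
  (forall t, Rmin a b <= t <= Rmax a b -> ccontinuous f (gamma t)) ->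
  is_CRInt (fun t => (v t * f (gamma t))%C) a b (F (gamma b) - F (gamma a))%C.
Proof.
intros Hg Hv HF Hf.
apply (is_RInt_derive (V := C_R_CompleteNormedModule) (fun t => F (gamma t))).
- intros t Ht; apply is_path_derive_comp; auto.
- intros t Ht.
  apply (continuous_Cmult (T := R_UniformSpace) (f := v) (g := fun t => f (gamma t))); [auto|].
  apply (continuous_comp (V := C_UniformSpace) gamma f); [|auto].
  apply (ex_derive_continuous (K := R_AbsRing) (V := C_R_NormedModule) gamma t).
  exists (v t); auto.
Qed.

Lemma boundary_int_primitive (D1 D2 : R -> Prop) (F f : C -> C) (a b c d : R) :
  convex_R D1 -> convex_R D2 ->
  (forall x y, D1 x -> D2 y -> is_cderive F (x, y) (f (x, y))) ->
  (forall x y, D1 x -> D2 y -> ccontinuous f (x, y)) ->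
  D1 a -> D1 b -> D2 c -> D2 d ->
  boundary_int f a b c d = RtoC 0.
Proof.
intros H1 H2 HF Hf Ha Hb Hc Hd.
assert (Eh : forall y, D2 y -> side_int_h f y a b = (F (b, y) - F (a, y))%C).
{ intros y Hy; apply (is_RInt_unique (V := C_R_CompleteNormedModule)).
  apply (is_RInt_ext (V := C_R_CompleteNormedModule) (fun t => (RtoC 1 * f (t, y))%C)).
  { intros t _; exact (Cmult_1_l _). }
  apply (CRInt_primitive (F := F) (f := f) (gamma := fun t => (t, y)) (v := fun _ => RtoC 1)).
  - intros; apply is_path_derive_h.
  - intros t Ht; apply (continuous_const (U := R_UniformSpace) (V := C_UniformSpace)).
  - intros t Ht; apply HF; [apply (H1 a b) | ]; assumption.
  - intros t Ht; apply Hf; [apply (H1 a b) | ]; assumption. }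
assert (Ev : forall x, D1 x -> side_int_v f x c d = (F (x, d) - F (x, c))%C).
{ intros x Hx; unfold side_int_v; rewrite <- CRInt_Cmult by exact (ex_side_int_v H2 Hf Hx Hc Hd).
  apply (is_RInt_unique (V := C_R_CompleteNormedModule)).
  apply (CRInt_primitive (F := F) (f := f) (gamma := fun t => (x, t)) (v := fun _ => Ci)).
  - intros; apply is_path_derive_v.
  - intros t Ht; apply (continuous_const (U := R_UniformSpace) (V := C_UniformSpace)).
  - intros t Ht; apply HF; [|apply (H2 c d)]; assumption.
  - intros t Ht; apply Hf; [|apply (H2 c d)]; assumption. }
unfold boundary_int; rewrite 2!Eh, 2!Ev by assumption; ring.
Qed.

(** * Goursat's lemma *)

Lemma side_int_h_minus (D1 D2 : R -> Prop) (f g : C -> C) (y a b : R) :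
  convex_R D1 ->
  (forall x y, D1 x -> D2 y -> ccontinuous f (x, y)) ->
  (forall x y, D1 x -> D2 y -> ccontinuous g (x, y)) ->
  D2 y -> D1 a -> D1 b ->
  side_int_h (fun z => f z - g z)%C y a b = (side_int_h f y a b - side_int_h g y a b)%C.
Proof.
intros; apply (RInt_minus (V := C_R_CompleteNormedModule)); now apply (ex_side_int_h (D1 := D1) (D2 := D2)).
Qed.

Lemma side_int_v_minus (D1 D2 : R -> Prop) (f g : C -> C) (x c d : R) :
  convex_R D2 ->
  (forall x y, D1 x -> D2 y -> ccontinuous f (x, y)) ->
  (forall x y, D1 x -> D2 y -> ccontinuous g (x, y)) ->
  D1 x -> D2 c -> D2 d ->
  side_int_v (fun z => f z - g z)%C x c d = (side_int_v f x c d - side_int_v g x c d)%C.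
Proof.
intros; unfold side_int_v.
rewrite (RInt_minus (V := C_R_CompleteNormedModule) (fun y => f (x, y)) (fun y => g (x, y)))
  by now apply (ex_side_int_v (D1 := D1) (D2 := D2)).
change minus with Cminus; ring.
Qed.

Lemma CRInt_const (c : C) (a b : R) : CRInt (fun _ => c) a b = (RtoC (b - a) * c)%C.
Proof.
rewrite (RInt_const (V := C_R_CompleteNormedModule) a b c).
destruct c as [c1 c2]; unfold scal; simpl; unfold prod_scal, scal; simpl.
unfold Cmult, RtoC, mult; simpl; f_equal; ring.
Qed.

Lemma side_int_h_const (c : C) (y a b : R) : side_int_h (fun _ => c) y a b = (RtoC (b - a) * c)%C.
Proof. apply CRInt_const. Qed.

Lemma side_int_v_const (u : C) (x c d : R) : side_int_v (fun _ => u) x c d = (Ci * RtoC (d - c) * u)%C.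
Proof. unfold side_int_v; rewrite CRInt_const; ring. Qed.

Lemma boundary_int_minus (D1 D2 : R -> Prop) (f g : C -> C) (a b c d : R) :
  convex_R D1 -> convex_R D2 ->
  (forall x y, D1 x -> D2 y -> ccontinuous f (x, y)) ->
  (forall x y, D1 x -> D2 y -> ccontinuous g (x, y)) ->
  D1 a -> D1 b -> D2 c -> D2 d ->
  boundary_int (fun z => f z - g z)%C a b c d =
    (boundary_int f a b c d - boundary_int g a b c d)%C.
Proof.
intros H1 H2 Hf Hg Ha Hb Hc Hd; unfold boundary_int.
rewrite 2!(side_int_h_minus H1 Hf Hg), 2!(side_int_v_minus H2 Hf Hg) by assumption; ring.
Qed.

(** An antiderivative of the first order expansion at [p] that Goursat's lemma
    subtracts. *)
Lemma is_cderive_affine_primitive (p u l z : C) :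
  is_cderive (fun w => (w - p) * u + (w - p) * (w - p) * l / 2)%C z (u + (z - p) * l)%C.
Proof.
apply is_cderive_Cmod; intros eps Heps.
assert (Hl := Cmod_ge_0 l).
exists (eps / (1 + Cmod l)); split; [apply Rdiv_lt_0_compat; lra|].
intros w Hw.
match goal with |- Cmod ?e <= _ => replace e with ((w - z) * ((w - z) * (l / 2)))%C end.
2: { field; intros E; injection E; lra. }
rewrite Cmod_mult, Rmult_comm.
apply Rmult_le_compat_r; [apply Cmod_ge_0|].
rewrite Cmod_mult, Cmod_div by (intros E; injection E; lra).
rewrite (Cmod_R 2), (Rabs_pos_eq 2) by lra.
apply Rle_trans with (eps / (1 + Cmod l) * (1 + Cmod l)).
- apply Rmult_le_compat; try lra; apply Cmod_ge_0 || lra.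
- right; field; lra.
Qed.

Lemma Cmod_rectangle (a b c d x y x' y' : R) :
  a <= x <= b -> a <= x' <= b -> c <= y <= d -> c <= y' <= d ->
  Cmod ((x, y) - (x', y'))%C <= (b - a) + (d - c).
Proof.
intros; apply Rle_trans with (1 := Cmod_le_abs _); simpl.
apply Rplus_le_compat; apply Rabs_le; lra.
Qed.

(** Near a point, [f] differs from an affine function by [eps] times the
    distance, and affine functions have primitives; so the boundary integral
    over a small rectangle is at most [2 * eps] times the square of the half
    perimeter. This bound is additive under quartering into four similar
    rectangles, hence it holds for the whole rectangle, for every [eps]. *)
Lemma Goursat_ordered (f : C -> C) (a b c d : R) :
  a <= b -> c <= d ->
  (forall x y, a <= x <= b -> c <= y <= d -> ex_cderive f (x, y)) ->
  boundary_int f a b c d = RtoC 0.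
Proof.
intros Hab Hcd Hf.
assert (Hc : forall x y, a <= x <= b -> c <= y <= d -> ccontinuous f (x, y)).
{ intros x y Hx Hy; destruct (Hf x y Hx Hy) as [l Hl]; apply (is_cderive_continuous Hl). }
assert (conv : forall u v, convex_R (fun x => u <= x <= v)).
{ intros u v r s x Hr Hs [H1 H2]; split.
  - apply Rle_trans with (2 := H1), Rmin_glb; lra.
  - apply Rle_trans with (1 := H2), Rmax_lub; lra. }
assert (key : forall eps, 0 < eps ->
  Cmod (boundary_int f a b c d) <= 2 * eps * (b - a + (d - c)) ^ 2).
{ intros eps Heps.
  pattern a at 1 2, b at 1 2, c at 1 2, d at 1 2.
  apply (rectangle_ind (a0 := a) (b0 := b) (c0 := c) (d0 := d)); try assumption.
  - intros a' b' c' d' Ha Hb Hc' Hd m n P1 P2 P3 P4; unfold m, n in *; clear m n.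
    rewrite (boundary_int_split (conv a b) (conv c d) Hc (a := a') (m := (a' + b') / 2) (b := b')
      (c := c') (n := (c' + d') / 2) (d := d')) by lra.
    apply Rle_trans with (1 := Cmod_triangle _ _).
    apply Rle_trans with (1 := Rplus_le_compat_r _ _ _ (Cmod_triangle _ _)).
    apply Rle_trans with (1 := Rplus_le_compat_r _ _ _ (Rplus_le_compat_r _ _ _ (Cmod_triangle _ _))).
    replace (2 * eps * (b' - a' + (d' - c')) ^ 2) with
      (2 * eps * ((a' + b') / 2 - a' + ((c' + d') / 2 - c')) ^ 2 +
       2 * eps * (b' - (a' + b') / 2 + ((c' + d') / 2 - c')) ^ 2 +
       2 * eps * ((a' + b') / 2 - a' + (d' - (c' + d') / 2)) ^ 2 +
       2 * eps * (b' - (a' + b') / 2 + (d' - (c' + d') / 2)) ^ 2) by field.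
    lra.
  - intros x y Hx Hy; destruct (Hf x y Hx Hy) as [l Hl].
    destruct (proj1 (is_cderive_Cmod _ _ _) Hl eps Heps) as [delta [Hd H]].
    exists (delta / 2); split; [lra|].
    intros a' b' c' d' Ha Hb Hc' Hd' Hw Hh.
    (* The first order expansion of [f] at the point. *)
    pose (g := fun z : C => (f (x, y) + (z - (x, y)) * l)%C).
    assert (Hg : forall x' y', ccontinuous g (x', y')).
    { intros x' y'.
      apply (continuous_plus (K := C_AbsRing) (V := C_NormedModule)).
      - apply (continuous_const (U := C_UniformSpace) (V := C_UniformSpace)).
      - apply (continuous_Cmult (T := C_UniformSpace)); [|apply (continuous_const (U := C_UniformSpace) (V := C_UniformSpace))].
        apply (continuous_minus (K := C_AbsRing) (V := C_NormedModule)).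
        + apply (continuous_id (U := C_UniformSpace)).
        + apply (continuous_const (U := C_UniformSpace) (V := C_UniformSpace)). }
    assert (E : boundary_int g a' b' c' d' = RtoC 0).
    { eapply (boundary_int_primitive (D1 := fun _ => True) (D2 := fun _ => True)); try easy.
      intros x' y' _ _; apply (is_cderive_affine_primitive (x, y) (f (x, y)) l (x', y')). }
    assert (E2 := boundary_int_minus (conv a b) (conv c d) Hc (g := g) (fun x y _ _ => Hg x y)
      (a := a') (b := b') (c := c') (d := d')).
    rewrite E in E2.
    replace (boundary_int f a' b' c' d') with (boundary_int f a' b' c' d' - 0)%C by ring.
    rewrite <- E2 by lra.
    apply Rle_trans with (2 * (Rabs (b' - a') + Rabs (d' - c')) * (eps * (b' - a' + (d' - c')))).
    2: { rewrite 2!Rabs_pos_eq by lra; right; ring. }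
    apply (boundary_int_bound (conv a b) (conv c d)); try lra.
    + intros x' y' Hx' Hy'; apply (continuous_minus (K := C_AbsRing) (V := C_NormedModule)); auto.
    + intros x' y' Hx' Hy'; rewrite Rmin_left, Rmax_right in Hx', Hy' by lra.
      assert (HM : Cmod ((x', y') - (x, y))%C <= b' - a' + (d' - c')) by (apply Cmod_rectangle; lra).
      unfold g; replace (f (x', y') - (f (x, y) + ((x', y') - (x, y)) * l))%C
        with (f (x', y') - f (x, y) - ((x', y') - (x, y)) * l)%C by ring.
      apply Rle_trans with (eps * Cmod ((x', y') - (x, y))%C).
      * apply H; lra.
      * apply Rmult_le_compat_l; lra. }
apply Cmod_eq_0, Rle_antisym; [|apply Cmod_ge_0].
apply le_epsilon; intros eps Heps; rewrite Rplus_0_l.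
set (s := b - a + (d - c)) in key.
assert (Hs : 0 <= s ^ 2) by apply pow2_ge_0.
assert (He : 0 < eps / (2 * (s ^ 2 + 1))) by (apply Rdiv_lt_0_compat; lra).
apply Rle_trans with (1 := key _ He).
apply Rle_trans with (eps * (s ^ 2 / (s ^ 2 + 1))); [right; field; lra|].
rewrite <- (Rmult_1_r eps) at 2; apply Rmult_le_compat_l; [lra|].
apply Rmult_le_reg_r with (s ^ 2 + 1); [lra|].
unfold Rdiv; rewrite Rmult_assoc, Rinv_l; lra.
Qed.

Lemma side_int_h_point (f : C -> C) (y a : R) : side_int_h f y a a = RtoC 0.
Proof. exact (RInt_point (V := C_R_CompleteNormedModule) a (fun x => f (x, y))). Qed.

Lemma side_int_v_point (f : C -> C) (x c : R) : side_int_v f x c c = RtoC 0.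
Proof.
unfold side_int_v; rewrite (RInt_point (V := C_R_CompleteNormedModule) c (fun y => f (x, y))).
exact (Cmult_0_r Ci).
Qed.

Lemma boundary_int_flat_h (f : C -> C) (a c d : R) : boundary_int f a a c d = RtoC 0.
Proof. unfold boundary_int; rewrite 2!side_int_h_point; ring. Qed.

Lemma boundary_int_flat_v (f : C -> C) (a b c : R) : boundary_int f a b c c = RtoC 0.
Proof. unfold boundary_int; rewrite 2!side_int_v_point; ring. Qed.

Lemma convex_R_segment (a b : R) : convex_R (fun x => Rmin a b <= x <= Rmax a b).
Proof.
intros u v x Hu Hv [H1 H2]; split.
- apply Rle_trans with (2 := H1), Rmin_glb; lra.
- apply Rle_trans with (1 := H2), Rmax_lub; lra.
Qed.

Lemma convex_R_interval (x0 r : R) : convex_R (fun x => Rabs (x - x0) < r).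
Proof.
intros u v x Hu Hv Hx; apply Rabs_def2 in Hu; apply Rabs_def2 in Hv.
unfold Rmin, Rmax in Hx; destruct (Rle_dec u v); apply Rabs_def1; lra.
Qed.

(** Reversing a side changes the sign of the boundary integral, so the order of
    the endpoints is immaterial. *)
Lemma Goursat (f : C -> C) (a b c d : R) :
  (forall x y, Rmin a b <= x <= Rmax a b -> Rmin c d <= y <= Rmax c d -> ex_cderive f (x, y)) ->
  boundary_int f a b c d = RtoC 0.
Proof.
intros Hf.
assert (Hc : forall x y, Rmin a b <= x <= Rmax a b -> Rmin c d <= y <= Rmax c d ->
  ccontinuous f (x, y)).
{ intros x y Hx Hy; destruct (Hf x y Hx Hy) as [l Hl]; apply (is_cderive_continuous Hl). }
assert (Ea : Rmin a b <= a <= Rmax a b) by (split; [apply Rmin_l | apply Rmax_l]).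
assert (Eb : Rmin a b <= b <= Rmax a b) by (split; [apply Rmin_r | apply Rmax_r]).
assert (Ec : Rmin c d <= c <= Rmax c d) by (split; [apply Rmin_l | apply Rmax_l]).
assert (Ed : Rmin c d <= d <= Rmax c d) by (split; [apply Rmin_r | apply Rmax_r]).
assert (Sh : forall c' d', (c' = c \/ c' = d) -> (d' = c \/ d' = d) ->
  boundary_int f a b c' d' = (- boundary_int f b a c' d')%C).
{ intros c' d' E1 E2.
  assert (S := boundary_int_split_h (convex_R_segment (a := a) (b := b)) Hc
    (a := a) (m := b) (b := a) (c := c') (d := d') Ea Eb Ea).
  rewrite boundary_int_flat_h in S.
  replace (- boundary_int f b a c' d')%C with (0 - boundary_int f b a c' d')%C by ring.
  rewrite S; [ring | |]; [destruct E1 | destruct E2]; subst; assumption. }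
assert (Sv : forall a' b', (a' = a \/ a' = b) -> (b' = a \/ b' = b) ->
  boundary_int f a' b' c d = (- boundary_int f a' b' d c)%C).
{ intros a' b' E1 E2.
  assert (S := boundary_int_split_v (convex_R_segment (a := c) (b := d)) Hc
    (a := a') (b := b') (c := c) (n := d) (d := c)).
  rewrite boundary_int_flat_v in S.
  replace (- boundary_int f a' b' d c)%C with (0 - boundary_int f a' b' d c)%C by ring.
  rewrite S; [ring | | | | |]; try assumption; [destruct E1 | destruct E2]; subst; assumption. }
destruct (Rle_dec a b) as [Hab|Hab], (Rle_dec c d) as [Hcd|Hcd].
- apply Goursat_ordered; try assumption; intros x y Hx Hy; apply Hf.
  + now rewrite Rmin_left, Rmax_right.
  + now rewrite Rmin_left, Rmax_right.
- rewrite Sv by auto; rewrite Goursat_ordered; [ring | lra | lra |].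
  intros x y Hx Hy; apply Hf.
  + now rewrite Rmin_left, Rmax_right.
  + rewrite Rmin_right, Rmax_left; lra.
- rewrite Sh by auto; rewrite Goursat_ordered; [ring | lra | lra |].
  intros x y Hx Hy; apply Hf.
  + rewrite Rmin_right, Rmax_left; lra.
  + now rewrite Rmin_left, Rmax_right.
- rewrite Sh, Sv by auto; rewrite Goursat_ordered; [ring | lra | lra |].
  intros x y Hx Hy; apply Hf; rewrite Rmin_right, Rmax_left; lra.
Qed.

(** * Primitives on a square *)

Lemma between_dist (a b x : R) : Rmin a b <= x <= Rmax a b -> Rabs (x - a) <= Rabs (b - a).
Proof.
unfold Rmin, Rmax, Rabs; destruct (Rle_dec a b), (Rcase_abs (x - a)), (Rcase_abs (b - a)); lra.
Qed.

Section Square.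

Variables (x0 y0 r : R) (f : C -> C).

Let D1 x := Rabs (x - x0) < r.
Let D2 y := Rabs (y - y0) < r.

Hypothesis Hc : forall x y, D1 x -> D2 y -> ccontinuous f (x, y).
Hypothesis Hf : forall x y, D1 x -> D2 y -> (x, y) <> (x0, y0) -> ex_cderive f (x, y).

Let conv1 : convex_R D1 := convex_R_interval (x0 := x0) (r := r).
Let conv2 : convex_R D2 := convex_R_interval (x0 := y0) (r := r).

(** When the exceptional point is a corner, Goursat's lemma removes all of the
    rectangle but a copy scaled by [s] at that corner, where [f] is bounded; the
    integral over its boundary is of order [s]. *)
Lemma boundary_int_corner (x y : R) : D1 x -> D2 y -> boundary_int f x0 x y0 y = RtoC 0.
Proof.
intros Hx Hy.
destruct (Req_dec x x0) as [->|Nx]; [apply boundary_int_flat_h|].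
destruct (Req_dec y y0) as [->|Ny]; [apply boundary_int_flat_v|].
assert (Hr : 0 < r) by (apply Rle_lt_trans with (2 := Hx), Rabs_pos).
assert (H1 : D1 x0) by (unfold D1; rewrite Rminus_diag, Rabs_R0; exact Hr).
assert (H2 : D2 y0) by (unfold D2; rewrite Rminus_diag, Rabs_R0; exact Hr).
assert (shrink : forall s, 0 < s <= 1 ->
  D1 (x0 + s * (x - x0)) /\ D2 (y0 + s * (y - y0)) /\
  boundary_int f x0 x y0 y = boundary_int f x0 (x0 + s * (x - x0)) y0 (y0 + s * (y - y0))).
{ intros s Hs; set (xs := x0 + s * (x - x0)); set (ys := y0 + s * (y - y0)).
  assert (Hxs : D1 xs).
  { unfold D1, xs; replace (x0 + s * (x - x0) - x0) with (s * (x - x0)) by ring.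
    rewrite Rabs_mult, (Rabs_pos_eq s) by lra.
    apply Rle_lt_trans with (2 := Hx); assert (K := Rabs_pos (x - x0)).
    rewrite <- (Rmult_1_l (Rabs (x - x0))) at 2; apply Rmult_le_compat_r; lra. }
  assert (Hys : D2 ys).
  { unfold D2, ys; replace (y0 + s * (y - y0) - y0) with (s * (y - y0)) by ring.
    rewrite Rabs_mult, (Rabs_pos_eq s) by lra.
    apply Rle_lt_trans with (2 := Hy); assert (K := Rabs_pos (y - y0)).
    rewrite <- (Rmult_1_l (Rabs (y - y0))) at 2; apply Rmult_le_compat_r; lra. }
  split; [exact Hxs | split; [exact Hys|]].
  assert (off : forall u0 u t, u <> u0 ->
    Rmin (u0 + s * (u - u0)) u <= t <= Rmax (u0 + s * (u - u0)) u -> t <> u0).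
  { intros u0 u t Nu Ht ->.
    destruct (Rlt_dec u0 u) as [L|L].
    - assert (0 < s * (u - u0)) by (apply Rmult_lt_0_compat; lra).
      unfold Rmin in Ht; destruct (Rle_dec (u0 + s * (u - u0)) u); lra.
    - assert (0 < s * (u0 - u)) by (apply Rmult_lt_0_compat; lra).
      unfold Rmax in Ht; destruct (Rle_dec (u0 + s * (u - u0)) u); lra. }
  rewrite (boundary_int_split conv1 conv2 Hc (a := x0) (m := xs) (b := x) (c := y0) (n := ys) (d := y))
    by assumption.
  rewrite (Goursat (a := xs) (b := x) (c := y0) (d := ys)).
  2: { intros x' y' Hx' Hy'; apply Hf; [now apply (conv1 Hxs Hx) | now apply (conv2 H2 Hys) |].
       intros E; injection E as E1 E2; now apply (off x0 x x' Nx Hx'). }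
  rewrite (Goursat (a := x0) (b := xs) (c := ys) (d := y)).
  2: { intros x' y' Hx' Hy'; apply Hf; [now apply (conv1 H1 Hxs) | now apply (conv2 Hys Hy) |].
       intros E; injection E as E1 E2; now apply (off y0 y y' Ny Hy'). }
  rewrite (Goursat (a := xs) (b := x) (c := ys) (d := y)).
  2: { intros x' y' Hx' Hy'; apply Hf; [now apply (conv1 Hxs Hx) | now apply (conv2 Hys Hy) |].
       intros E; injection E as E1 E2; now apply (off x0 x x' Nx Hx'). }
  ring. }
apply Cmod_eq_0, Rle_antisym; [|apply Cmod_ge_0].
apply le_epsilon; intros eps Heps; rewrite Rplus_0_l.
destruct (proj1 (ccontinuous_Cmod _ _) (Hc H1 H2) 1 Rlt_0_1) as [delta [Hd Hfd]].
set (M := Cmod (f (x0, y0)) + 1).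
assert (HM : 0 < M) by (unfold M; generalize (Cmod_ge_0 (f (x0, y0))); lra).
assert (HrM : 0 < r * M) by (apply Rmult_lt_0_compat; lra).
(* [s] keeps the scaled rectangle, of half perimeter at most [2 * s * r], within
   [delta] of the corner, and makes the bound [4 * s * r * M] at most [eps]. *)
set (s := Rmin (/ 2) (Rmin (delta / (4 * r)) (eps / (4 * (r * M))))).
assert (Hs0 : 0 < s).
{ repeat apply Rmin_pos; [lra | |]; apply Rdiv_lt_0_compat; lra. }
assert (Hs1 : s <= / 2) by apply Rmin_l.
assert (Hs2 : s * (4 * r) <= delta).
{ apply Rle_trans with (delta / (4 * r) * (4 * r)); [|right; field; lra].
  apply Rmult_le_compat_r; [lra|].
  apply Rle_trans with (1 := Rmin_r _ _), Rmin_l. }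
assert (Hs3 : s * (4 * (r * M)) <= eps).
{ apply Rle_trans with (eps / (4 * (r * M)) * (4 * (r * M))); [|right; field; lra].
  apply Rmult_le_compat_r; [lra|].
  apply Rle_trans with (1 := Rmin_r _ _), Rmin_r. }
assert (Hsr : 0 < s * r) by (apply Rmult_lt_0_compat; lra).
destruct (shrink s) as [Hxs [Hys ->]]; [lra|].
set (xs := x0 + s * (x - x0)) in *; set (ys := y0 + s * (y - y0)) in *.
assert (Dx : Rabs (xs - x0) <= s * r).
{ unfold xs; replace (x0 + s * (x - x0) - x0) with (s * (x - x0)) by ring.
  rewrite Rabs_mult, (Rabs_pos_eq s) by lra; apply Rmult_le_compat_l; [lra|].
  now apply Rlt_le. }
assert (Dy : Rabs (ys - y0) <= s * r).
{ unfold ys; replace (y0 + s * (y - y0) - y0) with (s * (y - y0)) by ring.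
  rewrite Rabs_mult, (Rabs_pos_eq s) by lra; apply Rmult_le_compat_l; [lra|].
  now apply Rlt_le. }
apply Rle_trans with (2 * (Rabs (xs - x0) + Rabs (ys - y0)) * M).
- apply (boundary_int_bound conv1 conv2 Hc); try assumption.
  intros x' y' Hx' Hy'.
  assert (K : Cmod ((x', y') - (x0, y0))%C < delta).
  { apply Rle_lt_trans with (1 := Cmod_le_abs _); simpl.
    apply between_dist in Hx'; apply between_dist in Hy'; unfold Rminus in *; lra. }
  specialize (Hfd _ K).
  replace (f (x', y')) with ((f (x', y') - f (x0, y0)) + f (x0, y0))%C by ring.
  apply Rle_trans with (1 := Cmod_triangle _ _); unfold M; lra.
- apply Rle_trans with (2 * (s * r + s * r) * M); [|lra].
  apply Rmult_le_compat_r; lra.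
Qed.

(** The vanishing of the integral over rectangles with a corner at the centre
    says that going first horizontally or first vertically from the centre to
    [(x, y)] gives the same value. The increment of this value from a point to a
    near one is then an integral along the two sides joining them. *)
Lemma square_primitive : exists F : C -> C, forall x y, D1 x -> D2 y ->
  is_cderive F (x, y) (f (x, y)).
Proof.
exists (fun z => side_int_h f y0 x0 (fst z) + side_int_v f (fst z) y0 (snd z))%C.
intros x y Hx Hy.
assert (Hr : 0 < r) by (apply Rle_lt_trans with (2 := Hx), Rabs_pos).
assert (H1 : D1 x0) by (unfold D1; rewrite Rminus_diag, Rabs_R0; exact Hr).
assert (H2 : D2 y0) by (unfold D2; rewrite Rminus_diag, Rabs_R0; exact Hr).
assert (other : forall x' y', D1 x' -> D2 y' ->
  (side_int_h f y0 x0 x' + side_int_v f x' y0 y')%C = (side_int_v f x0 y0 y' + side_int_h f y' x0 x')%C).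
{ intros x' y' Hx' Hy'; generalize (boundary_int_corner Hx' Hy'); unfold boundary_int.
  intros E; replace (side_int_h f y0 x0 x' + side_int_v f x' y0 y')%C
    with (side_int_h f y0 x0 x' + side_int_v f x' y0 y' - side_int_h f y' x0 x' - side_int_v f x0 y0 y' + (side_int_v f x0 y0 y' + side_int_h f y' x0 x'))%C by ring.
  rewrite E; ring. }
apply is_cderive_Cmod; intros eps Heps.
destruct (proj1 (ccontinuous_Cmod _ _) (Hc Hx Hy) (eps / 2)) as [delta [Hd Hfd]]; [lra|].
(* [rho] keeps the increment inside the square. *)
set (rho := Rmin (r - Rabs (x - x0)) (r - Rabs (y - y0))).
assert (Hrho : 0 < rho).
{ apply Rmin_pos; [unfold D1 in Hx | unfold D2 in Hy]; lra. }
exists (Rmin (delta / 2) rho); split; [apply Rmin_pos; lra|].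
intros [x' y'] Hw; simpl fst; simpl snd.
set (w := Cmod ((x', y') - (x, y))%C) in *.
assert (Hw1 : w < delta / 2) by (apply Rlt_le_trans with (1 := Hw), Rmin_l).
assert (Hw2 : w < rho) by (apply Rlt_le_trans with (1 := Hw), Rmin_r).
assert (Bx : Rabs (x' - x) <= w).
{ apply Rle_trans with (2 := Rmax_Cmod _); apply Rmax_l. }
assert (By : Rabs (y' - y) <= w).
{ apply Rle_trans with (2 := Rmax_Cmod _); apply Rmax_r. }
assert (Hx' : D1 x').
{ unfold D1; replace (x' - x0) with ((x' - x) + (x - x0)) by ring.
  apply Rle_lt_trans with (1 := Rabs_triang _ _).
  assert (rho <= r - Rabs (x - x0)) by apply Rmin_l; lra. }
assert (Hy' : D2 y').
{ unfold D2; replace (y' - y0) with ((y' - y) + (y - y0)) by ring.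
  apply Rle_lt_trans with (1 := Rabs_triang _ _).
  assert (rho <= r - Rabs (y - y0)) by apply Rmin_r; lra. }
assert (E1 : (side_int_h f y0 x0 x' + side_int_v f x' y0 y' - (side_int_h f y0 x0 x + side_int_v f x y0 y))%C =
  (side_int_h f y x x' + side_int_v f x' y y')%C).
{ rewrite (other x y Hx Hy).
  rewrite <- (side_int_v_Chasles conv2 Hc (x := x') (a := y0) (b := y) (c := y')) by assumption.
  replace (side_int_h f y0 x0 x' + (side_int_v f x' y0 y + side_int_v f x' y y'))%C
    with ((side_int_h f y0 x0 x' + side_int_v f x' y0 y) + side_int_v f x' y y')%C by ring.
  rewrite (other x' y Hx' Hy).
  rewrite <- (side_int_h_Chasles conv1 Hc (y := y) (a := x0) (b := x) (c := x')) by assumption.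
  ring. }
rewrite E1; clear E1.
set (g := fun _ : C => f (x, y)).
assert (Hg : forall u v, D1 u -> D2 v -> ccontinuous g (u, v)).
{ intros u v _ _; apply (continuous_const (U := C_UniformSpace) (V := C_UniformSpace)). }
assert (Hfg : forall u v, D1 u -> D2 v -> ccontinuous (fun z => f z - g z)%C (u, v)).
{ intros u v Hu Hv; apply (continuous_minus (K := C_AbsRing) (V := C_NormedModule)); auto. }
assert (E2 : (side_int_h f y x x' + side_int_v f x' y y' - ((x', y') - (x, y)) * f (x, y))%C =
  (side_int_h (fun z => f z - g z) y x x' + side_int_v (fun z => f z - g z) x' y y')%C).
{ rewrite (side_int_h_minus conv1 Hc Hg), (side_int_v_minus conv2 Hc Hg) by assumption.
  unfold g; rewrite side_int_h_const, side_int_v_const.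
  assert (E3 : ((x', y') - (x, y))%C = (RtoC (x' - x) + Ci * RtoC (y' - y))%C).
  { unfold Cminus, Copp, Cplus, Cmult, RtoC, Ci; simpl; f_equal; ring. }
  rewrite E3; ring. }
rewrite E2; clear E2.
apply Rle_trans with (1 := Cmod_triangle _ _).
assert (near : forall u v, Rabs (u - x) <= w -> Rabs (v - y) <= w ->
  Cmod (f (u, v) - g (u, v))%C <= eps / 2).
{ intros u v Hu Hv; apply Rlt_le, Hfd.
  apply Rle_lt_trans with (1 := Cmod_le_abs _); simpl; unfold Rminus in *; lra. }
assert (Hw0 : 0 <= w) by apply Cmod_ge_0.
assert (K1 : Cmod (side_int_h (fun z => f z - g z)%C y x x') <= Rabs (x' - x) * (eps / 2)).
{ apply (side_int_h_bound conv1 Hfg); try assumption.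
  intros u Hu; apply near; [apply between_dist in Hu; lra | rewrite Rminus_diag, Rabs_R0; lra]. }
assert (K2 : Cmod (side_int_v (fun z => f z - g z)%C x' y y') <= Rabs (y' - y) * (eps / 2)).
{ apply (side_int_v_bound conv2 Hfg); try assumption.
  intros u Hu; apply near; [assumption | apply between_dist in Hu; lra]. }
apply Rle_trans with (w * (eps / 2) + w * (eps / 2)); [|lra].
apply Rplus_le_compat.
- apply Rle_trans with (1 := K1), Rmult_le_compat_r; lra.
- apply Rle_trans with (1 := K2), Rmult_le_compat_r; lra.
Qed.

End Square.

(** * Integrals along cycles *)

Lemma rscal_C (r : R) (z : C) :
  scal (K := R_AbsRing) (V := C_R_NormedModule) r z = (RtoC r * z)%C.
Proof.
destruct z as [x y]; unfold scal; simpl; unfold prod_scal, scal; simpl.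
unfold Cmult, RtoC, mult; simpl; f_equal; ring.
Qed.

(** [C] carries two real module structures, as a product of two lines and by
    restriction of scalars. The integrals of the cycles use the second, the
    fundamental theorem of calculus needs the completeness of the first. *)
Lemma is_linear_real_C :
  is_linear (U := C_R_NormedModule) (V := real_NormedModule C_NormedModule) (fun z => z).
Proof.
split.
- easy.
- exact rscal_C.
- exists 1; split; [lra|]; intros z; rewrite Rmult_1_l, <- Cmod_norm; apply Rle_refl.
Qed.

Lemma is_linear_real (U V : NormedModule C_AbsRing) (L : U -> V) :
  is_linear L -> is_linear (U := real_NormedModule U) (V := real_NormedModule V) L.
Proof.
intros [Hp Hs Hn]; split; [exact Hp | intros r x; apply Hs | exact Hn].
Qed.

Lemma is_cycle_int_ext (V : NormedModule C_AbsRing) (Gamma : cycle) (F G : C -> V) (v : V) :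
  (forall gamma, In gamma Gamma -> forall t, 0 <= t <= 1 -> F (gamma t) = G (gamma t)) ->
  is_cycle_int Gamma F v -> is_cycle_int Gamma G v.
Proof.
intros H; apply is_RInt_ext; intros t Ht.
rewrite Rmin_left, Rmax_right in Ht by lra.
induction Gamma as [|gamma Gamma IH]; [reflexivity|]; simpl.
rewrite (H gamma (or_introl eq_refl) t) by lra.
apply f_equal, IH; intros g Hg; apply H; now right.
Qed.

Definition cycle_integrand (V : NormedModule C_AbsRing) (Gamma : cycle) (F : C -> V) (t : R) :
  real_NormedModule V :=
  fold_right plus zero
    (map (fun gamma : closed_path =>
       scal (K := C_AbsRing) (velocity gamma t) (F (gamma t))) Gamma).

Lemma cycle_integrand_plus (V : NormedModule C_AbsRing) (Gamma : cycle) (F G : C -> V) (t : R) :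
  plus (cycle_integrand Gamma F t) (cycle_integrand Gamma G t) =
  cycle_integrand Gamma (fun z => plus (F z) (G z)) t.
Proof.
induction Gamma as [|gamma Gamma IH]; [exact (plus_zero_l _)|].
set (a := scal (K := C_AbsRing) (velocity gamma t) (F (gamma t)) : real_NormedModule V).
set (b := scal (K := C_AbsRing) (velocity gamma t) (G (gamma t)) : real_NormedModule V).
transitivity (plus (plus a b) (cycle_integrand Gamma (fun z => plus (F z) (G z)) t)).
- rewrite <- IH.
  transitivity (plus (plus a (cycle_integrand Gamma F t)) (plus b (cycle_integrand Gamma G t)));
    [reflexivity|].
  rewrite <- 2!plus_assoc; apply f_equal; rewrite 2!plus_assoc.
  apply (f_equal (fun x => plus x _)), plus_comm.
- apply (f_equal (fun x => plus x _)).
  exact (eq_sym (scal_distr_l (velocity gamma t : C_AbsRing) (F (gamma t)) (G (gamma t)))).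
Qed.

Lemma is_cycle_int_plus (V : NormedModule C_AbsRing) (Gamma : cycle) (F G : C -> V) (u v : V) :
  is_cycle_int Gamma F u -> is_cycle_int Gamma G v ->
  is_cycle_int Gamma (fun z => plus (F z) (G z)) (plus u v).
Proof.
intros HF HG.
apply (is_RInt_ext (V := real_NormedModule V)) with (2 := is_RInt_plus _ _ _ _ _ _ HF HG).
intros t _; apply cycle_integrand_plus.
Qed.

Lemma cycle_integrand_linear (U V : NormedModule C_AbsRing) (L : U -> V) (Gamma : cycle)
  (F : C -> U) (t : R) :
  is_linear L ->
  L (cycle_integrand Gamma F t) = cycle_integrand Gamma (fun z => L (F z)) t.
Proof.
intros HL; induction Gamma as [|gamma Gamma IH]; [exact (linear_zero L HL)|].
transitivity (plus (L (scal (K := C_AbsRing) (velocity gamma t) (F (gamma t)))) (L (cycle_integrand Gamma F t))).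
- apply (linear_plus L HL).
- rewrite IH, (linear_scal L HL); reflexivity.
Qed.

Lemma is_cycle_int_linear (U V : NormedModule C_AbsRing) (L : U -> V) (Gamma : cycle)
  (F : C -> U) (v : U) :
  is_linear L -> is_cycle_int Gamma F v -> is_cycle_int Gamma (fun z => L (F z)) (L v).
Proof.
intros HL HF.
apply (is_RInt_ext (V := real_NormedModule V)) with (2 := is_RInt_linear (is_linear_real HL) HF).
intros t _; now apply cycle_integrand_linear.
Qed.

Lemma is_cycle_int_primitive (Omega : C -> Prop) (F k : C -> C) (Gamma : cycle) :
  (forall gamma, In gamma Gamma -> forall t, 0 <= t <= 1 -> Omega (gamma t)) ->
  (forall z, Omega z -> is_cderive F z (k z)) ->
  (forall z, Omega z -> ccontinuous k z) ->
  is_cycle_int (V := C_NormedModule) Gamma k (RtoC 0).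
Proof.
intros HG HF Hk.
induction Gamma as [|gamma Gamma IH]; unfold is_cycle_int; simpl.
- assert (H := is_RInt_const (V := real_NormedModule C_NormedModule) 0 1 zero).
  assert (E : scal (1 - 0) (zero : real_NormedModule C_NormedModule) = RtoC 0)
    by exact (scal_zero_r (1 - 0)).
  rewrite E in H; exact H.
- assert (E : plus (RtoC 0 : real_NormedModule C_NormedModule) (RtoC 0) = RtoC 0)
    by exact (Cplus_0_l _).
  rewrite <- E.
  apply (is_RInt_plus (V := real_NormedModule C_NormedModule)).
  2: { apply IH; intros g Hg; apply HG; now right. }
  apply (is_RInt_linear is_linear_real_C).
  assert (Hin : forall t, Rmin 0 1 <= t <= Rmax 0 1 -> Omega (gamma t)).
  { intros t Ht; rewrite Rmin_left, Rmax_right in Ht by lra; apply HG; [now left | exact Ht]. }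
  assert (H := CRInt_primitive (F := F) (f := k) (gamma := gamma) (v := velocity gamma) (a := 0) (b := 1)
    (fun t _ => path_derive gamma t) (fun t _ => @velocity_continuous gamma t)
    (fun t Ht => HF _ (Hin t Ht)) (fun t Ht => Hk _ (Hin t Ht))).
  rewrite <- (path_closed gamma) in H.
  replace (F (gamma 0) - F (gamma 0))%C with (RtoC 0) in H by ring; exact H.
Qed.

(** * Cauchy's formula *)

Lemma is_cderive_inv (p z : C) : z <> p ->
  is_cderive (fun w => / (w - p))%C z (- / ((z - p) * (z - p)))%C.
Proof.
intros Hz; apply is_cderive_Cmod; intros eps Heps.
assert (Nz : (z - p)%C <> RtoC 0).
{ intros E; apply Hz; replace z with (z - p + p)%C by ring; rewrite E; ring. }
set (m := Cmod (z - p)%C).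
assert (Hm : 0 < m) by now apply Cmod_gt_0.
exists (Rmin (m / 2) (eps * (m * m * m) / 2)); split.
{ apply Rmin_pos; [lra|].
  assert (0 < eps * (m * m * m)) by (repeat apply Rmult_lt_0_compat; assumption); lra. }
intros w Hw.
assert (Hw1 : Cmod (w - z)%C < m / 2) by (apply Rlt_le_trans with (1 := Hw), Rmin_l).
assert (Hw2 : Cmod (w - z)%C < eps * (m * m * m) / 2) by (apply Rlt_le_trans with (1 := Hw), Rmin_r).
assert (Hwp : m / 2 <= Cmod (w - p)%C).
{ assert (m <= Cmod (w - p)%C + Cmod (w - z)%C); [|lra].
  unfold m; replace (z - p)%C with ((w - p) + - (w - z))%C by ring.
  apply Rle_trans with (1 := Cmod_triangle _ _); rewrite Cmod_opp; lra. }
assert (Nw : (w - p)%C <> RtoC 0) by (apply Cmod_gt_0; lra).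
replace (/ (w - p) - / (z - p) - (w - z) * - / ((z - p) * (z - p)))%C
  with ((w - z) * ((w - z) / ((w - p) * ((z - p) * (z - p)))))%C by (field; split; assumption).
rewrite Cmod_mult, Rmult_comm; apply Rmult_le_compat_r; [apply Cmod_ge_0|].
rewrite Cmod_div, 2!Cmod_mult by (repeat apply Cmult_neq_0; assumption).
fold m.
assert (Hmm : 0 < m * m) by (apply Rmult_lt_0_compat; lra).
assert (Hden : m / 2 * (m * m) <= Cmod (w - p)%C * (m * m)) by (apply Rmult_le_compat_r; lra).
assert (Hpos : 0 < m / 2 * (m * m)) by (apply Rmult_lt_0_compat; lra).
apply Rmult_le_reg_r with (Cmod (w - p)%C * (m * m)); [lra|].
unfold Rdiv; rewrite Rmult_assoc, Rinv_l, Rmult_1_r by lra.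
apply Rle_trans with (eps * (m / 2 * (m * m))); [lra|].
apply Rmult_le_compat_l; lra.
Qed.

Lemma is_cderive_mult (f g : C -> C) (z l m : C) :
  is_cderive f z l -> is_cderive g z m ->
  is_cderive (fun w => f w * g w)%C z (l * g z + f z * m)%C.
Proof.
intros [_ Hf] [_ Hg].
destruct (is_derive_mult (K := C_AbsRing) f g z l m) as [_ H].
- split; [apply is_linear_scal_l | exact Hf].
- split; [apply is_linear_scal_l | exact Hg].
- exact Cmult_comm.
- split; [apply is_linear_scal_l | exact H].
Qed.

Lemma is_cderive_ext_near (f g : C -> C) (z l : C) (delta : R) :
  0 < delta -> (forall w, Cmod (w - z)%C < delta -> f w = g w) ->
  is_cderive f z l -> is_cderive g z l.
Proof.
intros Hd H; apply is_derive_ext_loc.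
apply locally_C, locally_Cmod; now exists delta.
Qed.

Definition slope (f : C -> C) (p l z : C) : C :=
  if excluded_middle_informative (z = p) then l else ((f z - f p) / (z - p))%C.

Lemma slope_eq (f : C -> C) (p l z : C) : z <> p -> slope f p l z = ((f z - f p) / (z - p))%C.
Proof. intros H; unfold slope; now destruct (excluded_middle_informative (z = p)). Qed.

Lemma Cminus_neq_0 (z p : C) : z <> p -> (z - p)%C <> RtoC 0.
Proof. intros H E; apply H; replace z with (z - p + p)%C by ring; rewrite E; ring. Qed.

Lemma slope_continuous (f : C -> C) (p l : C) : is_cderive f p l -> ccontinuous (slope f p l) p.
Proof.
rewrite is_cderive_Cmod, ccontinuous_Cmod; intros H eps Heps.
destruct (H (eps / 2)) as [delta [Hd Hw]]; [lra|].
exists delta; split; [exact Hd|]; intros w Hwd; specialize (Hw w Hwd).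
unfold slope at 2; destruct (excluded_middle_informative (p = p)) as [_|]; [|easy].
destruct (excluded_middle_informative (w = p)) as [->|N].
- unfold slope; destruct (excluded_middle_informative (p = p)) as [_|]; [|easy].
  replace (l - l)%C with (RtoC 0) by ring; rewrite Cmod_0; exact Heps.
- rewrite (slope_eq f l N); apply Cminus_neq_0 in N.
  replace ((f w - f p) / (w - p) - l)%C with ((f w - f p - (w - p) * l) / (w - p))%C
    by (field; exact N).
  rewrite Cmod_div by exact N.
  apply Cmod_gt_0 in N.
  apply Rle_lt_trans with (eps / 2); [|lra].
  apply Rmult_le_reg_r with (Cmod (w - p)%C); [exact N|].
  unfold Rdiv at 1; rewrite Rmult_assoc, Rinv_l, Rmult_1_r; lra.
Qed.

Lemma slope_derive (f : C -> C) (p l z : C) : z <> p -> ex_cderive f z -> ex_cderive (slope f p l) z.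
Proof.
intros N [m Hm]; eexists.
apply (is_cderive_ext_near (f := fun w => ((f w - f p) * / (w - p))%C) (delta := Cmod (z - p)%C)).
- apply Cmod_gt_0, Cminus_neq_0, N.
- intros w Hw; rewrite slope_eq; [reflexivity|].
  intros ->; revert Hw; replace (p - z)%C with (- (z - p))%C by ring; rewrite Cmod_opp; lra.
- apply is_cderive_mult; [|apply is_cderive_inv, N].
  apply (is_derive_minus (K := C_AbsRing) (V := C_NormedModule) f (fun _ => f p) z m zero Hm).
  apply is_derive_const.
Qed.

(** Holomorphy may fail at [p]: the functions to be integrated are difference
    quotients at [p], of which only continuity is known there. *)
Definition has_primitives (Omega : C -> Prop) (p : C) : Prop :=
  forall k : C -> C, (forall z, Omega z -> ccontinuous k z) ->
    (forall z, Omega z -> z <> p -> ex_cderive k z) ->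
    exists F, forall z, Omega z -> is_cderive F z (k z).

Lemma is_cycle_int_holomorphic (Omega : C -> Prop) (p : C) (k : C -> C) (Gamma : cycle) :
  has_primitives Omega p ->
  (forall gamma, In gamma Gamma -> forall t, 0 <= t <= 1 -> Omega (gamma t)) ->
  (forall z, Omega z -> ex_cderive k z) ->
  is_cycle_int (V := C_NormedModule) Gamma k (RtoC 0).
Proof.
intros Hp HG Hk.
assert (Hc : forall z, Omega z -> ccontinuous k z).
{ intros z Hz; destruct (Hk z Hz) as [l Hl]; exact (is_cderive_continuous Hl). }
destruct (Hp k Hc (fun z Hz _ => Hk z Hz)) as [F HF].
exact (is_cycle_int_primitive HG HF Hc).
Qed.

Lemma two_pi_i_neq_0 : (2 * PI * Ci)%C <> RtoC 0.
Proof.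
apply Cmult_neq_0; [apply Cmult_neq_0|]; intros E; injection E; generalize PI_RGT_0; lra.
Qed.

Lemma Cinv_mul (a b : C) : a <> RtoC 0 -> b <> RtoC 0 -> (/ (a * b) = / a * / b)%C.
Proof. intros Ha Hb; field; split; assumption. Qed.

Lemma kernel_derive (z w : C) : w <> z ->
  ex_cderive (fun u => / (2 * PI * Ci * (u - z)))%C w.
Proof.
intros N; eexists; apply (is_cderive_ext_near (f := fun u => (/ (2 * PI * Ci) * / (u - z))%C)
  (delta := Cmod (w - z)%C)).
- apply Cmod_gt_0, Cminus_neq_0, N.
- intros u Hu; symmetry; apply Cinv_mul; [exact two_pi_i_neq_0|].
  apply Cminus_neq_0; intros ->; revert Hu.
  replace (z - w)%C with (- (w - z))%C by ring; rewrite Cmod_opp; lra.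
- apply is_cderive_mult; [|apply is_cderive_inv, N].
  apply (is_derive_const (K := C_AbsRing) (V := C_NormedModule)).
Qed.

(** The Cauchy kernel of a point outside the domain is holomorphic on it. *)
Lemma winding_outside (Omega : C -> Prop) (p z : C) (Gamma : cycle) :
  has_primitives Omega p ->
  (forall gamma, In gamma Gamma -> forall t, 0 <= t <= 1 -> Omega (gamma t)) ->
  ~ Omega z -> is_winding Gamma z (RtoC 0).
Proof.
intros Hp HG Hz; apply (is_cycle_int_holomorphic Hp HG).
intros w Hw; apply kernel_derive; congruence.
Qed.

(** The difference quotient of [f] at [p], completed by the derivative, has a
    primitive, so its integral along a closed path vanishes; what remains of
    [f z / (z - p)] is [f p / (z - p)], which the winding number integrates. *)
Lemma Cauchy_formula (Omega : C -> Prop) (p : C) (f : C -> C) (Gamma : cycle) :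
  has_primitives Omega p -> Omega p ->
  (forall gamma, In gamma Gamma -> forall t, 0 <= t <= 1 -> Omega (gamma t) /\ gamma t <> p) ->
  is_winding Gamma p (RtoC 1) ->
  (forall z, Omega z -> ex_cderive f z) ->
  is_cycle_int (V := C_NormedModule) Gamma (fun z => f z / (2 * PI * Ci * (z - p)))%C (f p).
Proof.
intros Hprim Hp HG Hw Hf.
destruct (Hf p Hp) as [l Hl].
assert (Hqc : forall z, Omega z -> ccontinuous (slope f p l) z).
{ intros z Hz; destruct (excluded_middle_informative (z = p)) as [->|N].
  - exact (slope_continuous Hl).
  - destruct (slope_derive l N (Hf z Hz)) as [m Hm]; exact (is_cderive_continuous Hm). }
destruct (Hprim (slope f p l) Hqc) as [F HF].
{ intros z Hz N; exact (slope_derive l N (Hf z Hz)). }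
assert (Hq := is_cycle_int_primitive (fun g Hg t Ht => proj1 (HG g Hg t Ht)) HF Hqc).
assert (lin : forall c : C, is_linear (U := C_NormedModule) (V := C_NormedModule) (fun z => (c * z)%C)).
{ intros c; exact (is_linear_scal_r (V := C_NormedModule) c Cmult_comm). }
assert (H := is_cycle_int_plus (is_cycle_int_linear (lin (/ (2 * PI * Ci))%C) Hq)
  (is_cycle_int_linear (lin (f p)) Hw)).
replace (f p) with (plus (/ (2 * PI * Ci) * 0 : C_NormedModule)%C (f p * 1 : C_NormedModule)%C).
2: { change ((/ (2 * PI * Ci) * 0 + f p * 1)%C = f p); ring. }
revert H; apply is_cycle_int_ext; intros gamma Hgamma t Ht.
destruct (HG gamma Hgamma t Ht) as [_ N]; rewrite slope_eq by exact N.
apply Cminus_neq_0 in N; assert (N2 := two_pi_i_neq_0).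
change (/ (2 * PI * Ci) * ((f (gamma t) - f p) / (gamma t - p)) + f p * / (2 * PI * Ci * (gamma t - p)) =
  f (gamma t) / (2 * PI * Ci * (gamma t - p)))%C.
unfold Cdiv; rewrite (Cinv_mul N2 N); ring.
Qed.

(** * Two squares and two circles *)

Definition square (c : C) (r : R) (z : C) : Prop :=
  Rabs (fst z - fst c) < r /\ Rabs (snd z - snd c) < r.

(** Two components with disjoint closures, one around each eigenvalue: locally
    constant functions with two arbitrary values are then in the algebra. *)
Definition two_squares (z : C) : Prop := square (RtoC 2) 1 z \/ square (RtoC (-2)) 1 z.

Lemma square_has_primitives (c : C) (r : R) : has_primitives (square c r) c.
Proof.
intros k Hk Hd; destruct c as [x0 y0].
destruct (square_primitive (x0 := x0) (y0 := y0) (r := r) (f := k)) as [F HF].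
- intros x y Hx Hy; apply Hk; now split.
- intros x y Hx Hy N; apply Hd; [now split | exact N].
- exists F; intros [x y] [Hx Hy]; now apply HF.
Qed.

Lemma square_right (z : C) : square (RtoC 2) 1 z -> 1 < fst z.
Proof. intros [H _]; apply Rabs_def2 in H; simpl in H; lra. Qed.

Lemma square_left (z : C) : square (RtoC (-2)) 1 z -> fst z < -1.
Proof. intros [H _]; apply Rabs_def2 in H; simpl in H; lra. Qed.

Definition piecewise {A : Type} (a b : C -> A) (z : C) : A :=
  if Rlt_dec 0 (fst z) then a z else b z.

Lemma piecewise_right (A : Type) (a b : C -> A) (z : C) : 0 < fst z -> piecewise a b z = a z.
Proof. intros H; unfold piecewise; destruct (Rlt_dec 0 (fst z)); [reflexivity | lra]. Qed.

Lemma piecewise_left (A : Type) (a b : C -> A) (z : C) : fst z < 0 -> piecewise a b z = b z.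
Proof. intros H; unfold piecewise; destruct (Rlt_dec 0 (fst z)); [lra | reflexivity]. Qed.

Lemma fst_near (z w : C) : Cmod (w - z)%C < Rabs (fst z) -> Rabs (fst w - fst z) < Rabs (fst z).
Proof.
intros H; apply Rle_lt_trans with (2 := H).
apply Rle_trans with (2 := Rmax_Cmod _); apply Rmax_l.
Qed.

Lemma piecewise_derive_right (a b : C -> C) (z l : C) :
  0 < fst z -> is_cderive a z l -> is_cderive (piecewise a b) z l.
Proof.
intros Hz; apply (is_cderive_ext_near (delta := Rabs (fst z))).
- apply Rabs_pos_lt; lra.
- intros w Hw; apply fst_near in Hw; rewrite (Rabs_pos_eq (fst z)) in Hw by lra.
  apply Rabs_def2 in Hw; rewrite piecewise_right; [reflexivity | lra].
Qed.

Lemma piecewise_derive_left (a b : C -> C) (z l : C) :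
  fst z < 0 -> is_cderive b z l -> is_cderive (piecewise a b) z l.
Proof.
intros Hz; apply (is_cderive_ext_near (delta := Rabs (fst z))).
- apply Rabs_pos_lt; lra.
- intros w Hw; apply fst_near in Hw; rewrite (Rabs_left (fst z)) in Hw by lra.
  apply Rabs_def2 in Hw; rewrite piecewise_left; [reflexivity | lra].
Qed.

Lemma two_squares_has_primitives (p : C) :
  p = RtoC 2 \/ p = RtoC (-2) -> has_primitives two_squares p.
Proof.
intros Hp k Hk Hd.
assert (H : forall c, c = RtoC 2 \/ c = RtoC (-2) ->
  exists F, forall z, square c 1 z -> is_cderive F z (k z)).
{ intros c Hc; apply square_has_primitives.
  - intros z Hz; apply Hk; unfold two_squares; destruct Hc; subst; tauto.
  - intros z Hz N; apply Hd; [unfold two_squares; destruct Hc; subst; tauto|].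
    intros ->; destruct Hp, Hc; subst; try tauto.
    + apply square_left in Hz; simpl in Hz; lra.
    + apply square_right in Hz; simpl in Hz; lra. }
destruct (H (RtoC 2)) as [F1 HF1]; [tauto|].
destruct (H (RtoC (-2))) as [F2 HF2]; [tauto|].
exists (piecewise F1 F2); intros z [Hz|Hz].
- apply piecewise_derive_right; [apply square_right in Hz; lra | auto].
- apply piecewise_derive_left; [apply square_left in Hz; lra | auto].
Qed.

Lemma open_square (c : C) (r : R) : open (T := C_UniformSpace) (square c r).
Proof.
intros z [H1 H2]; apply locally_Cmod.
exists (Rmin (r - Rabs (fst z - fst c)) (r - Rabs (snd z - snd c))); split.
{ apply Rmin_pos; lra. }
intros w Hw; destruct (Rmin_Rgt_l _ _ _ Hw) as [Hw1 Hw2].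
assert (K1 : Rabs (fst w - fst z) <= Cmod (w - z)%C)
  by (apply Rle_trans with (2 := Rmax_Cmod _); apply Rmax_l).
assert (K2 : Rabs (snd w - snd z) <= Cmod (w - z)%C)
  by (apply Rle_trans with (2 := Rmax_Cmod _); apply Rmax_r).
split.
- replace (fst w - fst c) with ((fst w - fst z) + (fst z - fst c)) by ring.
  apply Rle_lt_trans with (1 := Rabs_triang _ _); lra.
- replace (snd w - snd c) with ((snd w - snd z) + (snd z - snd c)) by ring.
  apply Rle_lt_trans with (1 := Rabs_triang _ _); lra.
Qed.

Lemma open_two_squares : open (T := C_UniformSpace) two_squares.
Proof. apply open_or; apply open_square. Qed.

Lemma bounded_two_squares : bounded_set two_squares.
Proof.
exists 4; intros z Hz; apply Rle_trans with (1 := Cmod_le_abs _).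
assert (Rabs (fst z) <= 3 /\ Rabs (snd z) <= 1); [|lra].
destruct Hz as [[H1 H2]|[H1 H2]]; apply Rabs_def2 in H1; apply Rabs_def2 in H2; simpl in H1, H2;
  split; apply Rabs_le; lra.
Qed.

Lemma center_in_square (c : C) (r : R) : 0 < r -> square c r c.
Proof. intros Hr; split; rewrite Rminus_diag, Rabs_R0; exact Hr. Qed.

Definition unit_exp (t : R) : C := (cos (2 * PI * t), sin (2 * PI * t)).

Lemma unit_exp_Cmod (t : R) : Cmod (unit_exp t) = 1.
Proof.
unfold Cmod, unit_exp; simpl.
replace (_ + _) with (Rsqr (sin (2 * PI * t)) + Rsqr (cos (2 * PI * t))) by (unfold Rsqr; ring).
rewrite sin2_cos2; apply sqrt_1.
Qed.

Definition circle_fun (c : C) (rho : R) (t : R) : C := (c + RtoC rho * unit_exp t)%C.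

(** The derivative [2 pi i rho e^(2 pi i t)], in the form that cancels the Cauchy
    kernel at the centre. *)
Definition circle_velocity (c : C) (rho : R) (t : R) : C := (2 * PI * Ci * (circle_fun c rho t - c))%C.

Lemma circle_derive (c : C) (rho t : R) :
  is_path_derive (circle_fun c rho) t (circle_velocity c rho t).
Proof.
assert (Hcos : is_derive (K := R_AbsRing) (V := R_NormedModule) (fun s => cos (2 * PI * s)) t
  (- (2 * PI) * sin (2 * PI * t))) by (auto_derive; [easy | ring]).
assert (Hsin : is_derive (K := R_AbsRing) (V := R_NormedModule) (fun s => sin (2 * PI * s)) t
  (2 * PI * cos (2 * PI * t))) by (auto_derive; [easy | ring]).
assert (D := is_derive_plus (K := R_AbsRing) (V := C_R_NormedModule) _ _ t _ _
  (is_derive_const (K := R_AbsRing) (V := C_R_NormedModule) c t)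
  (is_derive_plus (K := R_AbsRing) (V := C_R_NormedModule) _ _ t _ _
    (is_derive_scal_l (K := R_AbsRing) (V := C_R_NormedModule) _ t _ (RtoC rho) Hcos)
    (is_derive_scal_l (K := R_AbsRing) (V := C_R_NormedModule) _ t _ (RtoC rho * Ci)%C Hsin))).
match type of D with is_derive _ _ ?l => assert (E : l = circle_velocity c rho t) end.
{ destruct c as [x y]; unfold circle_velocity, circle_fun, unit_exp.
  unfold plus, zero, scal; simpl; unfold prod_plus, prod_zero, prod_scal, plus, zero, scal; simpl.
  unfold Cminus, Copp, Cplus, Cmult, RtoC, Ci, mult; simpl; f_equal; ring. }
rewrite E in D; revert D; apply is_derive_ext; intros s.
destruct c as [x y]; unfold circle_fun, unit_exp.
unfold plus, zero, scal; simpl; unfold prod_plus, prod_zero, prod_scal, plus, zero, scal; simpl.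
unfold Cminus, Copp, Cplus, Cmult, RtoC, Ci, mult; simpl; f_equal; ring.
Qed.

Lemma circle_velocity_continuous (c : C) (rho t : R) :
  continuous (U := C_UniformSpace) (circle_velocity c rho) t.
Proof.
apply (continuous_Cmult (T := R_UniformSpace)).
- apply (continuous_const (U := R_UniformSpace) (V := C_UniformSpace)).
- apply (continuous_minus (U := R_UniformSpace) (K := C_AbsRing) (V := C_NormedModule) (circle_fun c rho) (fun _ => c)).
  + apply (ex_derive_continuous (K := R_AbsRing) (V := C_R_NormedModule) (circle_fun c rho) t).
    exists (circle_velocity c rho t); apply circle_derive.
  + apply (continuous_const (U := R_UniformSpace) (V := C_UniformSpace)).
Qed.

Lemma circle_closed (c : C) (rho : R) : circle_fun c rho 0 = circle_fun c rho 1.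
Proof.
unfold circle_fun, unit_exp.
now rewrite Rmult_0_r, Rmult_1_r, cos_0, sin_0, cos_2PI, sin_2PI.
Qed.

Definition circle (c : C) (rho : R) : closed_path :=
  Build_closed_path (circle_derive c rho) (@circle_velocity_continuous c rho) (circle_closed c rho).

Lemma circle_dist (c : C) (rho t : R) : 0 < rho -> Cmod (circle c rho t - c)%C = rho.
Proof.
intros Hr; simpl; unfold circle_fun.
replace (c + RtoC rho * unit_exp t - c)%C with (RtoC rho * unit_exp t)%C by ring.
rewrite Cmod_mult, unit_exp_Cmod, Cmod_R, Rabs_pos_eq; lra.
Qed.

Lemma circle_in_square (c : C) (rho r t : R) : 0 < rho < r -> square c r (circle c rho t).
Proof.
intros Hr; assert (K := Rmax_Cmod (circle c rho t - c)%C).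
rewrite circle_dist in K by lra; split.
- apply Rle_lt_trans with (2 := proj2 Hr), Rle_trans with (2 := K), Rmax_l.
- apply Rle_lt_trans with (2 := proj2 Hr), Rle_trans with (2 := K), Rmax_r.
Qed.

Lemma circle_winding (c : C) (rho : R) : 0 < rho -> is_winding (circle c rho :: nil) c (RtoC 1).
Proof.
intros Hr.
assert (E : scal (1 - 0) (RtoC 1 : real_NormedModule C_NormedModule) = RtoC 1).
{ change ((RtoC (1 - 0) * RtoC 1)%C = RtoC 1); rewrite Rminus_0_r; ring. }
assert (H := is_RInt_const (V := real_NormedModule C_NormedModule) 0 1 (RtoC 1)).
rewrite E in H; revert H; apply is_RInt_ext; intros t _.
change (RtoC 1 = (2 * PI * Ci * (circle_fun c rho t - c) * / (2 * PI * Ci * (circle_fun c rho t - c)) + 0)%C).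
rewrite Cplus_0_r, Cinv_r; [reflexivity|].
apply Cmult_neq_0; [exact two_pi_i_neq_0 | apply Cmod_gt_0].
change (0 < Cmod (circle c rho t - c)%C); rewrite circle_dist; exact Hr.
Qed.

Lemma is_cycle_int_cons (V : NormedModule C_AbsRing) (gamma : closed_path) (Gamma : cycle)
  (F : C -> V) (u v : V) :
  is_cycle_int (gamma :: nil) F u -> is_cycle_int Gamma F v ->
  is_cycle_int (gamma :: Gamma) F (plus u v).
Proof.
intros H1 H2.
apply (is_RInt_ext (V := real_NormedModule V)) with (2 := is_RInt_plus _ _ _ _ _ _ H1 H2).
intros t _; simpl; apply (f_equal (fun x : real_NormedModule V => plus x _)), plus_zero_r.
Qed.

Definition two_circles : cycle := circle (RtoC 2) (/ 2) :: circle (RtoC (-2)) (/ 2) :: nil.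

(** Each circle winds once around its own centre, and not around the other one,
    which lies outside the square that contains the circle. *)
Lemma two_circles_surround (K : C -> Prop) :
  (forall z, K z -> z = RtoC 2 \/ z = RtoC (-2)) -> surrounds two_circles K two_squares.
Proof.
intros HK.
assert (Hin : forall gamma, In gamma two_circles -> forall t, 0 <= t <= 1 -> two_squares (gamma t)).
{ intros gamma [<-|[<-|[]]] t _; [left | right]; apply circle_in_square; lra. }
assert (hol : forall c p, ~ square c 1 p -> is_winding (circle c (/ 2) :: nil) p (RtoC 0)).
{ intros c p Hp; apply (winding_outside (square_has_primitives (c := c) (r := 1))); [|exact Hp].
  intros gamma [<-|[]] t _; apply circle_in_square; lra. }
assert (N1 : ~ square (RtoC (-2)) 1 (RtoC 2)) by (intros H; apply square_left in H; simpl in H; lra).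
assert (N2 : ~ square (RtoC 2) 1 (RtoC (-2))) by (intros H; apply square_right in H; simpl in H; lra).
split; [|split].
- intros gamma Hg t Ht; split; [now apply Hin|].
  assert (D : forall c, circle c (/ 2) t <> c).
  { intros c E; assert (H := circle_dist c (rho := / 2) t ltac:(lra)); rewrite E in H.
    replace (c - c)%C with (RtoC 0) in H by ring; rewrite Cmod_0 in H; lra. }
  assert (S : forall c, square c 1 (circle c (/ 2) t)) by (intros c; apply circle_in_square; lra).
  intros Hk; apply HK in Hk; destruct Hg as [<-|[<-|[]]], Hk as [E|E];
    try (now apply (D _ E)).
  + apply N2; rewrite <- E; apply S.
  + apply N1; rewrite <- E; apply S.
- intros z Hz; apply HK in Hz; destruct Hz as [-> | ->].
  + replace (RtoC 1) with (plus (RtoC 1 : C_NormedModule) (RtoC 0)) by exact (Cplus_0_r _).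
    apply is_cycle_int_cons; [apply circle_winding; lra | now apply hol].
  + replace (RtoC 1) with (plus (RtoC 0 : C_NormedModule) (RtoC 1)) by exact (Cplus_0_l _).
    apply is_cycle_int_cons; [now apply hol | apply circle_winding; lra].
- intros z Hz.
  exact (winding_outside (two_squares_has_primitives (p := RtoC 2) (or_introl eq_refl)) Hin Hz).
Qed.

(** * The Hilbert space C^2 *)

Definition C2_lim (F : (C * C -> Prop) -> Prop) : C * C :=
  (CompleteSpace.lim _ C_CompleteSpace_mixin (filtermap fst F),
   CompleteSpace.lim _ C_CompleteSpace_mixin (filtermap snd F)).

Lemma C2_complete (F : (C * C -> Prop) -> Prop) :
  ProperFilter F -> cauchy (T := prod_UniformSpace C_UniformSpace C_UniformSpace) F ->
  forall eps : posreal, F (ball (M := prod_UniformSpace C_UniformSpace C_UniformSpace) (C2_lim F) eps).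
Proof.
intros HF Hc eps; apply filter_and.
- apply (CompleteSpace.ax1 _ C_CompleteSpace_mixin (filtermap fst F)).
  + apply filtermap_proper_filter, HF.
  + intros e; destruct (Hc e) as [x Hx]; exists (fst x).
    unfold filtermap; revert Hx; apply filter_imp; intros y [H _]; exact H.
- apply (CompleteSpace.ax1 _ C_CompleteSpace_mixin (filtermap snd F)).
  + apply filtermap_proper_filter, HF.
  + intros e; destruct (Hc e) as [x Hx]; exists (snd x).
    unfold filtermap; revert Hx; apply filter_imp; intros y [_ H]; exact H.
Qed.

Lemma C2_close_lim (F1 F2 : (C * C -> Prop) -> Prop) :
  filter_le F1 F2 -> filter_le F2 F1 ->
  close (M := prod_UniformSpace C_UniformSpace C_UniformSpace) (C2_lim F1) (C2_lim F2).
Proof.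
intros H1 H2 eps; split; apply (CompleteSpace.ax2 _ C_CompleteSpace_mixin);
  intros P HP; try (apply H1; exact HP); apply H2; exact HP.
Qed.

Definition C2_NormedModule : NormedModule C_AbsRing :=
  prod_NormedModule C_AbsRing C_NormedModule C_NormedModule.

Definition C2_CompleteNormedModule : CompleteNormedModule C_AbsRing :=
  CompleteNormedModule.Pack C_AbsRing (C * C)
    (CompleteNormedModule.Class C_AbsRing (C * C) (NormedModule.class C_AbsRing C2_NormedModule)
      (CompleteSpace.Mixin (prod_UniformSpace C_UniformSpace C_UniformSpace) C2_lim C2_complete C2_close_lim))
    (C * C).

Definition C2_inner (x y : C2_CompleteNormedModule) : C :=
  (fst x * Cconj (fst y) + snd x * Cconj (snd y))%C.

Lemma C2_norm (u v : C) :
  norm ((u, v) : C2_CompleteNormedModule) = sqrt (Cmod u ^ 2 + Cmod v ^ 2).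
Proof. reflexivity. Qed.

Lemma C2_inner_plus (x y z : C2_CompleteNormedModule) :
  C2_inner (plus x y) z = (C2_inner x z + C2_inner y z)%C.
Proof.
change (((fst x + fst y) * Cconj (fst z) + (snd x + snd y) * Cconj (snd z) =
  C2_inner x z + C2_inner y z)%C); unfold C2_inner; ring.
Qed.

Lemma C2_inner_scal (a : C) (x y : C2_CompleteNormedModule) :
  C2_inner (scal (K := C_AbsRing) a x) y = (a * C2_inner x y)%C.
Proof.
change ((a * fst x * Cconj (fst y) + a * snd x * Cconj (snd y) = a * C2_inner x y)%C).
unfold C2_inner; ring.
Qed.

Lemma C2_inner_conj (x y : C2_CompleteNormedModule) : C2_inner y x = Cconj (C2_inner x y).
Proof.
unfold C2_inner; rewrite Cplus_conj, 2!Cmult_conj, 2!Cconj_conj; ring.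
Qed.

Lemma C2_inner_norm (x : C2_CompleteNormedModule) : C2_inner x x = RtoC (norm x ^ 2).
Proof.
destruct x as [u v]; rewrite C2_norm, pow2_sqrt.
- unfold C2_inner; simpl fst; simpl snd; rewrite RtoC_plus, 2!Cmod2_conj; reflexivity.
- assert (0 <= Cmod u ^ 2) by apply pow2_ge_0; assert (0 <= Cmod v ^ 2) by apply pow2_ge_0; lra.
Qed.

Definition C2 : Hilbert :=
  Build_Hilbert C2_inner_plus C2_inner_scal C2_inner_conj C2_inner_norm.

(** * Operators on C^2 *)

Definition mat_fun (a b c d : C) (x : C2) : C2 :=
  ((a * fst x + b * snd x)%C, (c * fst x + d * snd x)%C).

Lemma mat_linear (a b c d : C) : is_linear (mat_fun a b c d).
Proof.
assert (row : forall a b : C, is_linear (U := C2_NormedModule) (V := C_NormedModule)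
  (fun x => (a * fst x + b * snd x)%C)).
{ clear; intros a b.
  assert (S : forall c : C, is_linear (U := C_NormedModule) (V := C_NormedModule) (fun z => (c * z)%C)).
  { intros c; exact (is_linear_scal_r (V := C_NormedModule) c Cmult_comm). }
  exact (is_linear_comp (fun x : C2_NormedModule => ((a * fst x)%C, (b * snd x)%C))
    (fun y => plus (fst y) (snd y))
    (is_linear_prod _ _ (is_linear_comp _ _ is_linear_fst (S a)) (is_linear_comp _ _ is_linear_snd (S b)))
    (is_linear_plus (V := C_NormedModule))). }
exact (is_linear_prod (U := C_NormedModule) (V := C_NormedModule) _ _ (row a b) (row c d)).
Qed.

Definition mat (a b c d : C) : bdop C2 := Build_bdop (mat_linear a b c d).

Lemma mat_plus (a b c d a' b' c' d' : C) :
  plus (mat a b c d) (mat a' b' c' d') = mat (a + a') (b + b') (c + c') (d + d').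
Proof.
apply bdop_ext; intros [u v].
change (((a * u + b * v + (a' * u + b' * v))%C, (c * u + d * v + (c' * u + d' * v))%C) =
  (((a + a') * u + (b + b') * v)%C, ((c + c') * u + (d + d') * v)%C)).
f_equal; ring.
Qed.

Lemma mat_scal (k a b c d : C) :
  scal (K := C_AbsRing) k (mat a b c d) = mat (k * a) (k * b) (k * c) (k * d).
Proof.
apply bdop_ext; intros [u v].
change (((k * (a * u + b * v))%C, (k * (c * u + d * v))%C) =
  ((k * a * u + k * b * v)%C, (k * c * u + k * d * v)%C)).
f_equal; ring.
Qed.

Lemma mat_id : bdop_id C2 = mat 1 0 0 1.
Proof.
apply bdop_ext; intros [u v].
change ((u, v) = ((1 * u + 0 * v)%C, (0 * u + 1 * v)%C)); f_equal; ring.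
Qed.

Lemma mat_comp (a b c d a' b' c' d' : C) :
  bdop_comp (mat a b c d) (mat a' b' c' d') =
  mat (a * a' + b * c') (a * b' + b * d') (c * a' + d * c') (c * b' + d * d').
Proof.
apply bdop_ext; intros [u v].
change (((a * (a' * u + b' * v) + b * (c' * u + d' * v))%C,
         (c * (a' * u + b' * v) + d * (c' * u + d' * v))%C) =
  (((a * a' + b * c') * u + (a * b' + b * d') * v)%C,
   ((c * a' + d * c') * u + (c * b' + d * d') * v)%C)).
f_equal; ring.
Qed.

Lemma is_inverse_unique (V : NormedModule C_AbsRing) (A B B' : bdop V) :
  is_inverse A B -> is_inverse A B' -> B = B'.
Proof.
intros [_ HB] [HB' _]; apply bdop_ext; intros x.
transitivity (bdop_comp B (bdop_comp A B') x).
- now rewrite HB'.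
- exact (f_equal (fun D : bdop V => D (B' x)) HB).
Qed.

Lemma inverse_eq (V : NormedModule C_AbsRing) (A B : bdop V) : is_inverse A B -> inverse A = B.
Proof.
intros H; apply (is_inverse_unique (A := A)); [|exact H].
unfold inverse; apply epsilon_spec; now exists B.
Qed.

Lemma is_adjoint_unique (H : Hilbert) (A B B' : bdop H) :
  is_adjoint A B -> is_adjoint A B' -> B = B'.
Proof.
intros HB HB'; apply bdop_ext; intros y.
set (w := minus (B y) (B' y)).
assert (Hw : inner w w = RtoC 0).
{ assert (E : inner (B y) w = inner (B' y) w).
  { rewrite (inner_conj w (B y)), (inner_conj w (B' y)).
    now rewrite <- HB, <- HB'. }
  assert (O : inner (opp (B' y)) w = (- inner (B' y) w)%C).
  { transitivity (inner (scal (K := C_AbsRing) (Copp 1) (B' y)) w).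
    - apply (f_equal (fun u => inner u w)), eq_sym; exact (scal_opp_one (B' y)).
    - rewrite inner_scal; ring. }
  unfold w at 1; unfold minus; rewrite inner_plus, E, O; ring. }
rewrite inner_norm in Hw; apply (f_equal fst) in Hw; simpl in Hw.
assert (Hn : norm w = 0) by nra.
apply norm_eq_zero in Hn; unfold w in Hn.
transitivity (plus (minus (B y) (B' y)) (B' y)).
- unfold minus; now rewrite <- plus_assoc, plus_opp_l, plus_zero_r.
- rewrite Hn; apply plus_zero_l.
Qed.

Lemma adjoint_mat (a b c d : C) :
  adjoint (H := C2) (mat a b c d) = mat (Cconj a) (Cconj c) (Cconj b) (Cconj d).
Proof.
assert (H : is_adjoint (H := C2) (mat a b c d) (mat (Cconj a) (Cconj c) (Cconj b) (Cconj d))).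
{ intros [u v] [u' v'].
  change (((a * u + b * v) * Cconj u' + (c * u + d * v) * Cconj v' =
    u * Cconj (Cconj a * u' + Cconj c * v') + v * Cconj (Cconj b * u' + Cconj d * v'))%C).
  rewrite 2!Cplus_conj, 4!Cmult_conj, 4!Cconj_conj; ring. }
apply (is_adjoint_unique (A := mat a b c d : bdop C2)); [|exact H].
unfold adjoint; apply epsilon_spec; eexists; exact H.
Qed.

(** * The functional calculus of the oblique operator *)

(** [2 * P - 2 * (1 - P)] for the oblique projection [P] below. *)
Definition oblique_op : bdop C2 := mat 2 4 0 (-2).

(** The projection onto the first axis along the line spanned by [(1, -1)]: these
    lines make an angle of [PI / 4]. *)
Definition oblique_proj : bdop C2 := mat 1 1 0 0.
Definition oblique_coproj : bdop C2 := mat 0 (-1) 0 1.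

Lemma shift_oblique (z : C) :
  minus (scal (K := C_AbsRing) z (bdop_id C2)) oblique_op = mat (z - 2) (-4) 0 (z - -2).
Proof.
apply bdop_ext; intros [u v].
change (((z * u + - (1) * (2 * u + 4 * v))%C, (z * v + - (1) * (0 * u + (-2) * v))%C) =
  (((z - 2) * u + (-4) * v)%C, (0 * u + (z - -2) * v)%C)).
f_equal; unfold Cminus; rewrite ?RtoC_opp; ring.
Qed.

Lemma mat_apply (a b c d u v : C) :
  mat a b c d ((u, v) : C2) = ((a * u + b * v)%C, (c * u + d * v)%C).
Proof. reflexivity. Qed.

(** The inverse is the value at the operator of [w => / (z - w)], that is, the
    combination of the two projections with the values at the eigenvalues. *)
Lemma oblique_is_inverse (z : C) : z <> RtoC 2 -> z <> RtoC (-2) ->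
  is_inverse (minus (scal (K := C_AbsRing) z (bdop_id C2)) oblique_op)
    (plus (scal (K := C_AbsRing) (/ (z - 2))%C oblique_proj) (scal (K := C_AbsRing) (/ (z - -2))%C oblique_coproj)).
Proof.
intros H1 H2; apply Cminus_neq_0 in H1; apply Cminus_neq_0 in H2.
unfold oblique_proj, oblique_coproj; rewrite shift_oblique, 2!mat_scal, mat_plus.
split; rewrite mat_comp, mat_id; f_equal; rewrite ?RtoC_opp in *; field; split; assumption.
Qed.

Lemma oblique_spectrum (z : C) : spectrum oblique_op z <-> z = RtoC 2 \/ z = RtoC (-2).
Proof.
split.
- intros Hs; apply NNPP; intros N; apply Hs; eexists; apply oblique_is_inverse; tauto.
- (* Used for the eigenvectors (1, 0) and (1, -1), normalized by their first
     coordinate so that they are visibly not zero. *)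
  assert (eig : forall x : C2, (fst x : C) = RtoC 1 -> bdop_fun (minus (scal (K := C_AbsRing) z (bdop_id C2)) oblique_op) x = zero ->
    spectrum oblique_op z).
  { intros x Hx E [B [_ HB]].
    apply (f_equal (fun A : bdop C2 => A x)) in HB; simpl in HB.
    change (B (bdop_fun (minus (scal (K := C_AbsRing) z (bdop_id C2)) oblique_op) x) = x) in HB.
    rewrite E, (linear_zero _ (bdop_linear B)) in HB.
    rewrite <- HB in Hx; injection Hx; lra. }
  intros [-> | ->].
  + apply (eig (RtoC 1, RtoC 0)); [reflexivity|].
    rewrite shift_oblique, mat_apply; apply injective_projections;
      unfold Cplus, Cminus, Copp, Cmult, RtoC; simpl; apply injective_projections; simpl; ring.
  + apply (eig (RtoC 1, RtoC (-1))); [reflexivity|].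
    rewrite shift_oblique, mat_apply; apply injective_projections;
      unfold Cplus, Cminus, Copp, Cmult, RtoC; simpl; apply injective_projections; simpl; ring.
Qed.

Lemma oblique_resolvent (z : C) : z <> RtoC 2 -> z <> RtoC (-2) ->
  resolvent oblique_op z =
  plus (scal (K := C_AbsRing) (/ (z - 2))%C oblique_proj) (scal (K := C_AbsRing) (/ (z - -2))%C oblique_coproj).
Proof. intros H1 H2; apply inverse_eq, oblique_is_inverse; assumption. Qed.

Lemma is_linear_scal_op (V : NormedModule C_AbsRing) (x : V) :
  is_linear (U := C_NormedModule) (V := V) (fun k : C => scal (K := C_AbsRing) k x).
Proof.
destruct (is_linear_scal_l (K := C_AbsRing) x) as [Hp Hs Hn].
split; [exact Hp | exact Hs | exact Hn].
Qed.

Lemma oblique_calc_integral (f : C -> C) (Gamma : cycle) :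
  (forall z, two_squares z -> ex_cderive f z) ->
  surrounds Gamma (spectrum oblique_op) two_squares ->
  is_cycle_int Gamma
    (fun zeta => scal (K := C_AbsRing) (f zeta / (2 * PI * Ci))%C (resolvent oblique_op zeta))
    (plus (scal (K := C_AbsRing) (f 2) oblique_proj) (scal (K := C_AbsRing) (f (-2)) oblique_coproj)).
Proof.
intros Hf [HG [Hw _]].
assert (S2 : spectrum oblique_op (RtoC 2)) by (apply oblique_spectrum; now left).
assert (Sm : spectrum oblique_op (RtoC (-2))) by (apply oblique_spectrum; now right).
assert (avoid : forall p, spectrum oblique_op p -> forall gamma, In gamma Gamma -> forall t, 0 <= t <= 1 ->
  two_squares (gamma t) /\ gamma t <> p).
{ intros p Hp gamma Hg t Ht; destruct (HG gamma Hg t Ht) as [H1 H2].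
  split; [exact H1 | intros E; apply H2; now rewrite E]. }
assert (formula : forall p, spectrum oblique_op p ->
  is_cycle_int (V := C_NormedModule) Gamma (fun z => f z / (2 * PI * Ci * (z - p)))%C (f p)).
{ intros p Hp; apply (Cauchy_formula (Omega := two_squares)); auto.
  - now apply two_squares_has_primitives, oblique_spectrum.
  - apply oblique_spectrum in Hp; destruct Hp as [-> | ->]; [left | right]; apply center_in_square; lra. }
assert (H := is_cycle_int_plus (is_cycle_int_linear (is_linear_scal_op oblique_proj) (formula _ S2))
  (is_cycle_int_linear (is_linear_scal_op oblique_coproj) (formula _ Sm))).
revert H; apply is_cycle_int_ext; intros gamma Hg t Ht.
assert (N2 := proj2 (avoid _ S2 gamma Hg t Ht)); assert (Nm := proj2 (avoid _ Sm gamma Hg t Ht)).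
rewrite oblique_resolvent by assumption.
apply Cminus_neq_0 in N2; apply Cminus_neq_0 in Nm; assert (Npi := two_pi_i_neq_0).
unfold oblique_proj, oblique_coproj; rewrite !mat_scal, !mat_plus, mat_scal.
unfold Cdiv; rewrite (Cinv_mul Npi N2), (Cinv_mul Npi Nm).
f_equal; ring.
Qed.

(** The Cauchy integral has the same value for every admissible cycle, and the
    two circles form one, so the choice made by [hol_calc] is harmless. *)
Lemma oblique_hol_calc (f : C -> C) :
  (forall z, two_squares z -> ex_cderive f z) ->
  hol_calc two_squares f oblique_op = mat (f 2) (f 2 - f (-2)) 0 (f (-2)).
Proof.
intros Hf.
replace (mat (f 2) (f 2 - f (-2)) 0 (f (-2)))
  with (plus (scal (K := C_AbsRing) (f 2) oblique_proj) (scal (K := C_AbsRing) (f (-2)) oblique_coproj)).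
2: { unfold oblique_proj, oblique_coproj; rewrite !mat_scal, mat_plus; f_equal; rewrite ?RtoC_opp; ring. }
unfold hol_calc.
match goal with |- epsilon ?i ?P = ?v => assert (HP : P (epsilon i P)) end.
{ apply epsilon_spec; eexists; exists two_circles; split.
  - apply two_circles_surround; intros z; apply oblique_spectrum.
  - apply oblique_calc_integral; [exact Hf|].
    apply two_circles_surround; intros z; apply oblique_spectrum. }
destruct HP as [Gamma [HG HI]].
exact (is_RInt_value_unique HI (oblique_calc_integral Hf HG)).
Qed.

(** * Two norms *)

(** The matrix is a multiple of a rotation by a right angle. *)
Lemma skew_norm (k : C) : bdop_norm (mat 0 k (- k) 0) <= Cmod k.
Proof.
apply bdop_norm_le; intros [u v] Hx; rewrite mat_apply.
assert (E : norm ((((0 * u + k * v)%C, (- k * u + 0 * v)%C)) : C2) = Cmod k * norm ((u, v) : C2)).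
{ change (sqrt (Cmod (0 * u + k * v) ^ 2 + Cmod (- k * u + 0 * v) ^ 2) =
    Cmod k * sqrt (Cmod u ^ 2 + Cmod v ^ 2)).
  replace (0 * u + k * v)%C with (k * v)%C by ring.
  replace (- k * u + 0 * v)%C with (- (k * u))%C by ring.
  rewrite Cmod_opp, 2!Cmod_mult.
  rewrite <- (sqrt_pow2 (Cmod k)) at 3 by apply Cmod_ge_0.
  rewrite <- sqrt_mult_alt by apply pow2_ge_0; f_equal; ring. }
apply Rle_trans with (1 := Req_le _ _ E).
rewrite <- (Rmult_1_r (Cmod k)) at 2; apply Rmult_le_compat_l; [apply Cmod_ge_0 | exact Hx].
Qed.

(** The matrix is [2 * P - 1]. For [p = |u|], [q = |v|] and [s = sqrt 2], the
    upper bound is the identity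
    [(1 + s)^2 (p^2 + q^2) - ((p + 2 q)^2 + q^2) = (2 s + 2) (p - (s - 1) q)^2],
    and equality occurs for [p = sin (PI / 8)], [q = cos (PI / 8)]. *)
Lemma reflection_norm : bdop_norm (mat 1 2 0 (-1)) = 1 + sqrt 2.
Proof.
assert (Hs : sqrt 2 * sqrt 2 = 2) by (apply sqrt_def; lra).
assert (Hs1 : 1 < sqrt 2) by (rewrite <- sqrt_1 at 1; apply sqrt_lt_1; lra).
assert (Hs2 : sqrt 2 < 2) by nra.
set (s := sqrt 2) in *.
apply Rle_antisym.
- apply bdop_norm_le; intros [u v] Hx; rewrite mat_apply.
  refine (Rle_trans _ _ _ (Req_le _ _ (C2_norm _ _)) _).
  assert (Hx' : sqrt (Cmod u ^ 2 + Cmod v ^ 2) <= 1) by exact Hx.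
  replace (0 * u + -1 * v)%C with (- v)%C by (rewrite ?RtoC_opp; ring).
  rewrite Cmod_opp.
  assert (Hp := Cmod_ge_0 u); assert (Hq := Cmod_ge_0 v).
  assert (Ht : Cmod (1 * u + 2 * v)%C <= Cmod u + 2 * Cmod v).
  { apply Rle_trans with (1 := Cmod_triangle _ _).
    rewrite 2!Cmod_mult, 2!Cmod_R, 2!Rabs_pos_eq; lra. }
  assert (Ht0 := Cmod_ge_0 (1 * u + 2 * v)%C).
  set (p := Cmod u) in *; set (q := Cmod v) in *; set (m := Cmod (1 * u + 2 * v)%C) in *.
  assert (Hpq : p ^ 2 + q ^ 2 <= 1).
  { assert (0 <= p ^ 2 + q ^ 2) by nra.
    rewrite <- (sqrt_def (p ^ 2 + q ^ 2)) by assumption.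
    assert (0 <= sqrt (p ^ 2 + q ^ 2)) by apply sqrt_pos; nra. }
  rewrite <- (sqrt_pow2 (1 + s)) by lra.
  apply sqrt_le_1_alt.
  assert (m ^ 2 <= (p + 2 * q) ^ 2) by (apply pow_incr; lra).
  assert ((1 + s) ^ 2 * (p ^ 2 + q ^ 2) - ((p + 2 * q) ^ 2 + q ^ 2) =
    (2 * s + 2) * (p - (s - 1) * q) ^ 2 + (s * s - 2) * (p ^ 2 + q ^ 2 + 4 * p * q - 2 * (s - 1) * q ^ 2)) by ring.
  assert (0 <= (2 * s + 2) * (p - (s - 1) * q) ^ 2) by (apply Rmult_le_pos; [lra | apply pow2_ge_0]).
  replace (s * s - 2) with 0 in * by lra.
  assert ((1 + s) ^ 2 * (p ^ 2 + q ^ 2) <= (1 + s) ^ 2 * 1)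
    by (apply Rmult_le_compat_l; [apply pow2_ge_0 | exact Hpq]).
  lra.
- set (p := sqrt (2 - s) / 2); set (q := sqrt (2 + s) / 2).
  assert (Hp2 : p * p = (2 - s) / 4).
  { unfold p; replace (sqrt (2 - s) / 2 * (sqrt (2 - s) / 2)) with
      (sqrt (2 - s) * sqrt (2 - s) / 4) by field; rewrite sqrt_def by lra; reflexivity. }
  assert (Hq2 : q * q = (2 + s) / 4).
  { unfold q; replace (sqrt (2 + s) / 2 * (sqrt (2 + s) / 2)) with
      (sqrt (2 + s) * sqrt (2 + s) / 4) by field; rewrite sqrt_def by lra; reflexivity. }
  assert (Hpq : p * q = s / 4).
  { unfold p, q; replace (sqrt (2 - s) / 2 * (sqrt (2 + s) / 2)) with
      (sqrt (2 - s) * sqrt (2 + s) / 4) by field; rewrite <- sqrt_mult by lra.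
    replace ((2 - s) * (2 + s)) with 2 by (ring_simplify; nra); reflexivity. }
  assert (Hn : norm ((RtoC p, RtoC q) : C2) <= 1).
  { refine (Rle_trans _ _ _ (Req_le _ _ (C2_norm _ _)) _).
    rewrite 2!Cmod_R, <- sqrt_1; apply sqrt_le_1_alt; rewrite 2!pow2_abs; nra. }
  refine (Rle_trans _ _ _ _ (bdop_norm_ub (mat 1 2 0 (-1)) Hn)).
  rewrite mat_apply; refine (Rle_trans _ _ _ _ (Req_le _ _ (eq_sym (C2_norm _ _)))).
  replace (1 * RtoC p + 2 * RtoC q)%C with (RtoC (p + 2 * q))
    by (rewrite RtoC_plus, RtoC_mult; ring).
  replace (0 * RtoC p + -1 * RtoC q)%C with (RtoC (- q)) by (rewrite ?RtoC_opp; ring).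
  rewrite 2!Cmod_R, 2!pow2_abs.
  rewrite <- (sqrt_pow2 (1 + s)) by lra; apply sqrt_le_1_alt; nra.
Qed.

(** * The algebra of the two squares *)

Lemma Omega_closure (Omega : C -> Prop) (z : C) : Omega z -> closure Omega z.
Proof.
intros Hz eps Heps; exists z; split; [exact Hz|].
replace (z - z)%C with (RtoC 0) by ring; rewrite Cmod_0; exact Heps.
Qed.

(** [sup_norm] takes the real part of an extended supremum, which is the actual
    supremum only if the function is bounded and the set not empty. *)
Lemma sup_norm_is_lub (Omega : C -> Prop) (f : C -> C) (M : R) (z0 : C) :
  Omega z0 -> (forall z, Omega z -> Cmod (f z) <= M) ->
  is_lub_Rbar (fun r => exists z, Omega z /\ r = Cmod (f z)) (sup_norm Omega f).
Proof.
intros H0 HM; unfold sup_norm.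
set (E := fun r => exists z, Omega z /\ r = Cmod (f z)).
destruct (Lub_Rbar_correct E) as [H1 H2].
assert (HE : E (Cmod (f z0))) by (now exists z0).
assert (Hub : is_ub_Rbar E M) by (intros r [z [Hz ->]]; exact (HM z Hz)).
generalize (H1 _ HE) (H2 _ Hub) (conj H1 H2).
destruct (Lub_Rbar E); simpl; easy.
Qed.

(** Locally bounded, hence bounded, by induction on rectangles. *)
Lemma continuous_on_bounded_rectangle (Omega : C -> Prop) (f : C -> C) (a b c d : R) :
  a <= b -> c <= d ->
  (forall x y, a <= x <= b -> c <= y <= d -> closure Omega (x, y)) ->
  continuous_on (T := C_UniformSpace) (U := C_UniformSpace) (closure Omega) f ->
  exists M, forall x y, a <= x <= b -> c <= y <= d -> Cmod (f (x, y)) <= M.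
Proof.
intros Hab Hcd Hcl Hf.
apply (rectangle_ind (P := fun a b c d =>
  exists M, forall x y, a <= x <= b -> c <= y <= d -> Cmod (f (x, y)) <= M)); try assumption.
- intros a' b' c' d' _ _ _ _ m n [M1 H1] [M2 H2] [M3 H3] [M4 H4].
  exists (Rmax (Rmax M1 M2) (Rmax M3 M4)); intros x y Hx Hy.
  destruct (Rle_dec x m), (Rle_dec y n).
  + apply Rle_trans with (2 := Rmax_l _ _), Rle_trans with (2 := Rmax_l _ _), H1; lra.
  + apply Rle_trans with (2 := Rmax_r _ _), Rle_trans with (2 := Rmax_l _ _), H3; lra.
  + apply Rle_trans with (2 := Rmax_l _ _), Rle_trans with (2 := Rmax_r _ _), H2; lra.
  + apply Rle_trans with (2 := Rmax_r _ _), Rle_trans with (2 := Rmax_r _ _), H4; lra.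
- intros x y Hx Hy.
  assert (H := Hf _ (Hcl x y Hx Hy)).
  apply filterlim_Cmod with (eps := 1) in H; [|apply within_filter, locally_filter | lra].
  apply locally_Cmod in H; destruct H as [delta [Hd H]].
  exists (delta / 2); split; [lra|].
  intros a' b' c' d' Ha Hb Hc Hd' Hw Hh; exists (Cmod (f (x, y)) + 1); intros x' y' Hx' Hy'.
  assert (K : Cmod ((x', y') - (x, y))%C < delta).
  { apply Rle_lt_trans with (b' - a' + (d' - c')); [apply Cmod_rectangle; lra | lra]. }
  specialize (H _ K (Hcl x' y' ltac:(lra) ltac:(lra))).
  replace (f (x', y')) with ((f (x', y') - f (x, y)) + f (x, y))%C by ring.
  apply Rle_trans with (1 := Cmod_triangle _ _); lra.
Qed.

Lemma square_closure (c : C) (r x y : R) : 0 < r ->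
  fst c - r <= x <= fst c + r -> snd c - r <= y <= snd c + r -> closure (square c r) (x, y).
Proof.
intros Hr Hx Hy eps Heps; destruct c as [x0 y0]; simpl in Hx, Hy.
set (t := Rmin (/ 2) (eps / (4 * r))).
assert (Ht0 : 0 < t) by (apply Rmin_pos; [lra | apply Rdiv_lt_0_compat; lra]).
assert (Ht1 : t <= / 2) by apply Rmin_l.
assert (Ht2 : t * (4 * r) <= eps).
{ apply Rle_trans with (eps / (4 * r) * (4 * r)); [|right; field; lra].
  apply Rmult_le_compat_r; [lra | apply Rmin_r]. }
assert (shrink : forall u u0, u0 - r <= u <= u0 + r ->
  Rabs (u0 + (1 - t) * (u - u0) - u0) < r /\ Rabs (u0 + (1 - t) * (u - u0) - u) <= t * r).
{ intros u u0 Hu; assert (Hur : Rabs (u - u0) <= r) by (apply Rabs_le; lra).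
  assert (H0 := Rabs_pos (u - u0)); split.
  - replace (u0 + (1 - t) * (u - u0) - u0) with ((1 - t) * (u - u0)) by ring.
    rewrite Rabs_mult, Rabs_pos_eq by lra; nra.
  - replace (u0 + (1 - t) * (u - u0) - u) with (- (t * (u - u0))) by ring.
    rewrite Rabs_Ropp, Rabs_mult, Rabs_pos_eq by lra; apply Rmult_le_compat_l; lra. }
destruct (shrink x x0 Hx) as [X1 X2]; destruct (shrink y y0 Hy) as [Y1 Y2].
exists (x0 + (1 - t) * (x - x0), y0 + (1 - t) * (y - y0)); split; [now split|].
apply Rle_lt_trans with (1 := Cmod_le_abs _); simpl; unfold Rminus in *.
assert (0 < t * r) by (apply Rmult_lt_0_compat; lra); lra.
Qed.

Lemma closure_mono (U V : C -> Prop) (z : C) :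
  (forall w, U w -> V w) -> closure U z -> closure V z.
Proof. intros H Hz eps Heps; destruct (Hz eps Heps) as [w [Hw Hd]]; exists w; auto. Qed.

Lemma in_A_bounded (f : C -> C) : in_A two_squares f ->
  exists M, forall z, two_squares z -> Cmod (f z) <= M.
Proof.
intros [Hf _].
assert (B : forall c, c = RtoC 2 \/ c = RtoC (-2) ->
  exists M, forall z, square c 1 z -> Cmod (f z) <= M).
{ intros c Hc.
  destruct (continuous_on_bounded_rectangle (Omega := two_squares) (f := f)
    (a := fst c - 1) (b := fst c + 1) (c := snd c - 1) (d := snd c + 1)) as [M HM]; try lra; [|exact Hf|].
  - intros x y Hx Hy; apply (closure_mono (U := square c 1)); [|now apply square_closure; lra].
    intros w Hw; unfold two_squares; destruct Hc; subst; tauto.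
  - exists M; intros [x y] [Hx Hy]; simpl in Hx, Hy.
    apply Rabs_def2 in Hx; apply Rabs_def2 in Hy; apply HM; lra. }
destruct (B (RtoC 2)) as [M1 H1]; [tauto|]; destruct (B (RtoC (-2))) as [M2 H2]; [tauto|].
exists (Rmax M1 M2); intros z [Hz|Hz].
- apply Rle_trans with (2 := Rmax_l _ _); auto.
- apply Rle_trans with (2 := Rmax_r _ _); auto.
Qed.

Lemma center_right : two_squares (RtoC 2).
Proof. left; apply center_in_square; lra. Qed.

Lemma center_left : two_squares (RtoC (-2)).
Proof. right; apply center_in_square; lra. Qed.

Lemma sup_norm_ub (f : C -> C) (z : C) :
  in_A two_squares f -> two_squares z -> Cmod (f z) <= sup_norm two_squares f.
Proof.
intros Hf Hz; destruct (in_A_bounded Hf) as [M HM].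
apply (proj1 (sup_norm_is_lub center_right HM)); now exists z.
Qed.

Lemma sup_norm_le (f : C -> C) (M : R) :
  (forall z, two_squares z -> Cmod (f z) <= M) -> sup_norm two_squares f <= M.
Proof.
intros HM; apply (proj2 (sup_norm_is_lub center_right HM) (Finite M)).
intros r [z [Hz ->]]; exact (HM z Hz).
Qed.

Definition step (a b : C) : C -> C := piecewise (fun _ => a) (fun _ => b).

Lemma step_right (a b z : C) : 0 < fst z -> step a b z = a.
Proof. apply (piecewise_right (fun _ => a) (fun _ => b)). Qed.

Lemma step_left (a b z : C) : fst z < 0 -> step a b z = b.
Proof. apply (piecewise_left (fun _ => a) (fun _ => b)). Qed.

Lemma step_derive (a b z : C) : fst z <> 0 -> ex_cderive (step a b) z.
Proof.
intros Hz; exists zero; destruct (Rlt_dec 0 (fst z)).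
- apply piecewise_derive_right; [assumption | apply (is_derive_const (K := C_AbsRing) (V := C_NormedModule))].
- apply piecewise_derive_left; [lra | apply (is_derive_const (K := C_AbsRing) (V := C_NormedModule))].
Qed.

Lemma two_squares_off_axis (z : C) : two_squares z -> 1 < Rabs (fst z).
Proof.
intros [H|H].
- apply square_right in H; rewrite Rabs_pos_eq; lra.
- apply square_left in H; rewrite Rabs_left; lra.
Qed.

Lemma step_in_A (a b : C) : in_A two_squares (step a b).
Proof.
split.
- intros z Hz.
  assert (N : fst z <> 0).
  { destruct (Hz 1 Rlt_0_1) as [w [Hw Hd]]; intros E.
    apply two_squares_off_axis in Hw.
    assert (K := Rle_trans _ _ _ (Rmax_l _ _) (Rmax_Cmod (w - z)%C)); simpl in K.
    rewrite E, Ropp_0, Rplus_0_r in K; lra. }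
  destruct (step_derive a b N) as [l Hl].
  apply (filterlim_filter_le_1 (F := locally z)); [|exact (is_cderive_continuous Hl)].
  intros P HP; revert HP; unfold within; apply filter_imp; auto.
- intros z Hz; apply step_derive; intros E; apply two_squares_off_axis in Hz.
  rewrite E, Rabs_R0 in Hz; lra.
Qed.

Lemma step_Cmod (a b z : C) (M : R) : Cmod a <= M -> Cmod b <= M -> Cmod (step a b z) <= M.
Proof. intros Ha Hb; unfold step, piecewise; destruct (Rlt_dec 0 (fst z)); assumption. Qed.

Lemma step_center_right (a b : C) : step a b (RtoC 2) = a.
Proof. apply step_right; simpl; lra. Qed.

Lemma step_center_left (a b : C) : step a b (RtoC (-2)) = b.
Proof. apply step_left; simpl; lra. Qed.

Theorem mainTheorem2 :
  exists (H : Hilbert) (T : bdop H) (Omega : C -> Prop),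
    open (T := C_UniformSpace) Omega /\
    bounded_set Omega /\
    (forall z, spectrum T z -> Omega z) /\
    (forall f, in_A Omega f ->
       exists g, in_A Omega g /\
         sup_norm Omega g <= sup_norm Omega f /\
         norm (plus (hol_calc Omega f T) (adjoint (hol_calc Omega g T)))
           <= 2 * sup_norm Omega f) /\
    (exists f, in_A Omega f /\
       (exists z, closure Omega z /\ f z <> RtoC 0) /\
       norm (hol_calc Omega f T) = (1 + sqrt 2) * sup_norm Omega f).
Proof.
exists C2, oblique_op, two_squares.
split; [exact open_two_squares|].
split; [exact bounded_two_squares|].
split.
{ intros z Hz; apply oblique_spectrum in Hz; destruct Hz as [-> | ->];
    [exact center_right | exact center_left]. }
split.
- intros f Hf.
  assert (F1 := sup_norm_ub Hf center_right); assert (F2 := sup_norm_ub Hf center_left).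
  (* With [a = f 2] and [b = f (-2)], the diagonal of [f(T) + g(T)^*] vanishes and
     [(a - b, b - a)] remains off the diagonal. *)
  set (g := step (- Cconj (f 2)) (- Cconj (f (-2)))).
  assert (Hg : in_A two_squares g) by apply step_in_A.
  exists g; split; [exact Hg|]; split.
  + apply sup_norm_le; intros z _; apply step_Cmod; now rewrite Cmod_opp, Cmod_conj.
  + rewrite (oblique_hol_calc (proj2 Hf)), (oblique_hol_calc (proj2 Hg)), adjoint_mat, mat_plus.
    unfold g; rewrite step_center_right, step_center_left.
    replace (mat _ _ _ _) with (mat 0 (f 2 - f (-2)) (- (f 2 - f (-2))) 0).
    2: { rewrite Cminus_conj, 2!Copp_conj, 2!Cconj_conj.
         replace (Cconj 0) with (RtoC 0) by (unfold Cconj, RtoC; simpl; f_equal; ring).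
         f_equal; ring. }
    apply Rle_trans with (1 := skew_norm _).
    unfold Cminus; apply Rle_trans with (1 := Cmod_triangle _ _); rewrite Cmod_opp; lra.
- set (f := step 1 (-1)).
  assert (Hf : in_A two_squares f) by apply step_in_A.
  assert (Hsup : sup_norm two_squares f = 1).
  { apply Rle_antisym.
    - apply sup_norm_le; intros z _; apply step_Cmod; rewrite Cmod_R.
      + rewrite Rabs_R1; lra.
      + rewrite Rabs_left; lra.
    - apply Rle_trans with (2 := sup_norm_ub Hf center_right).
      unfold f; rewrite step_center_right, Cmod_1; lra. }
  exists f; split; [exact Hf|]; split.
  + exists (RtoC 2); split; [exact (Omega_closure center_right)|].
    unfold f; rewrite step_center_right; intros E; injection E; lra.
  + rewrite (oblique_hol_calc (proj2 Hf)), Hsup, Rmult_1_r.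
    unfold f; rewrite step_center_right, step_center_left.
    replace (1 - -1)%C with (RtoC 2) by (rewrite <- RtoC_minus; f_equal; ring).
    exact reflection_norm.
Qed.
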